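(* For every $\alpha>0$, the generalized Alexander operator $C_{g_0}$ is a compact linear operator from $(\mathcal{B}_\alpha^0,\|\cdot\|_{\mathcal{B}_\alpha})$ to itself.
   Context: $\mathbb{D}=\{z\in\mathbb{C}:|z|<1\}$. For $\alpha>0$, the $\alpha$-Bloch space $\mathcal{B}_\alpha$ is the space of analytic functions $f$ on $\mathbb{D}$ with $\|f\|_{\mathcal{B}_\alpha}:=\sup_{z\in\mathbb{D}}(1-|z|^2)^\alpha|f'(z)|<\infty$. $\mathcal{B}_\alpha^0=\{f\in\mathcal{B}_\alpha: f(0)=0\}$, normed by $\|\cdot\|_{\mathcal{B}_\alpha}$. Let $g_0(w)=\sum_{j=1}^k a_j+h(w)$, where $k\ge1$, $a_j\in\mathbb{C}$ with $|a_j|>0$, and $h$ is a bounded analytic function on $\mathbb{D}$ (this is the case $\beta=0$ of $g_\beta(w)=\sum_{j=1}^k a_j(1-b_jw)^{-\beta}+h(w)$ with $b_j$ distinct points of the unit circle). The generalized Alexander operator is $C_{g_0}(f)(z)=\int_0^z\frac{f(w)g_0(w)}{w}\,dw$ for analytic $f$ on $\mathbb{D}$ with $f(0)=0$. *)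

(* Defs.v *)
From Stdlib Require Import Reals.
From Coquelicot Require Import Coquelicot.
Open Scope R_scope.

Definition analytic_D (f : C -> C) : Prop :=
  forall z : C, Cmod z < 1 -> ex_derive f z.

Definition bloch_weight (alpha : R) (z : C) : R :=
  Rpower (1 - Cmod z ^ 2) alpha.

Definition in_Bloch (alpha : R) (f : C -> C) : Prop :=
  analytic_D f /\
  exists M : R, forall z : C, Cmod z < 1 ->
    bloch_weight alpha z * Cmod (C_derive f z) <= M.

Definition in_Bloch0 (alpha : R) (f : C -> C) : Prop :=
  in_Bloch alpha f /\ f 0%C = 0%C.

Definition bloch_norm (alpha : R) (f : C -> C) : R :=
  real (Lub_Rbar (fun r => exists z : C, Cmod z < 1 /\
          r = bloch_weight alpha z * Cmod (C_derive f z))).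

Fixpoint csum (a : nat -> C) (k : nat) : C :=
  match k with
  | O => 0%C
  | S k' => (csum a k' + a k')%C
  end.

(* g_0(w) = sum_{j=1}^k a_j + h(w)  (here indexed j = 0 .. k-1) *)
Definition g0 (k : nat) (a : nat -> C) (h : C -> C) (w : C) : C :=
  (csum a k + h w)%C.

(* C_g(f)(z) = int_0^z f(w) g(w) / w dw, integrated along the segment
   [0, z], i.e. = z * int_0^1 f(tz) g(tz) / (tz) dt. *)
Definition alexander (g : C -> C) (f : C -> C) (z : C) : C :=
  (z * @RInt C_R_CompleteNormedModule
         (fun t : R => f (RtoC t * z)%C * g (RtoC t * z)%C / (RtoC t * z))%C
         0 1)%C.

Definition maps_Bloch0 (alpha : R) (T : (C -> C) -> (C -> C)) : Prop :=
  forall f, in_Bloch0 alpha f -> in_Bloch0 alpha (T f).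

Definition linear_on_Bloch0 (alpha : R) (T : (C -> C) -> (C -> C)) : Prop :=
  forall (f1 f2 : C -> C) (c1 c2 : C),
    in_Bloch0 alpha f1 -> in_Bloch0 alpha f2 ->
    forall z : C, Cmod z < 1 ->
      T (fun w => c1 * f1 w + c2 * f2 w)%C z = (c1 * T f1 z + c2 * T f2 z)%C.

Definition compact_on_Bloch0 (alpha : R) (T : (C -> C) -> (C -> C)) : Prop :=
  forall u : nat -> (C -> C),
    (forall n, in_Bloch0 alpha (u n)) ->
    (exists M : R, forall n, bloch_norm alpha (u n) <= M) ->
    exists phi : nat -> nat, (forall n, (phi n < phi (S n))%nat) /\
    exists g : C -> C, in_Bloch0 alpha g /\
      is_lim_seq (fun n => bloch_norm alpha
                     (fun z => (T (u (phi n)) z - g z)%C)) 0.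

(* Main.v *)
(* If f(0) = 0, write f = z V with V analytic; then C_g f is the primitive of V g that vanishes at 0, and Bloch's condition on f gives (1-|z|^2)^alpha |V(z)| <= ||f||, so C_g is bounded by sup |g|.

   Compactness: a bounded sequence u_n has Taylor coefficients bounded by Cauchy's estimates, so a diagonal subsequence converges coefficientwise to some f, and u_n - f = z V_n with V_n -> 0 uniformly on compact subsets.  Near the unit circle no convergence is needed: comparing v(z) with v(sz) gives
     (1-|z|^2)^alpha |V(z)| <= (1-s) ||v|| + ||v|| ((1-|z|^2)/(1-s^2))^alpha,
   which is small uniformly over bounded v once s is close to 1 and then |z| is close to 1.

   Taylor expansion rests on Goursat's bisection, applied to f(z)/(z-a) on the homotopy a + s (r e^{it} - a) that contracts the circle |z| = r to the point a. *)
Require Import Defs.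
From Stdlib Require Import Reals Lra Lia Psatz IndefiniteDescription.
From Coquelicot Require Import Coquelicot.
Open Scope R_scope.

(** * Complex differentiability *)

(** [analytic_D] asks for a complex derivative at each point and nothing about its continuity, so
    neither Stokes nor differentiation under the integral is at hand; this is what forces Goursat.
    Paths are pulled back to parameter rectangles, so that bisection acts on real intervals. The
    cone over the circle is cut at a positive height, away from the pole at its apex; its two
    straight sides coincide by periodicity and cancel. The total mass of the Cauchy kernel is left
    unevaluated in that argument and is computed afterwards by expanding the case f = 1.

    Coefficients read off on different circles must first be identified; only then does a single
    sequence satisfy Cauchy's estimate on every circle inside the disc. Bounds |c_n| r^n <= K for
    each r < 1 then control all sums.

    In the limit V is followed rather than f: the derivative of the image of f is V g, so the Bloch
    norm of a difference of images involves no derivative of u_n, and locally uniform convergence of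
    V_n is enough in the interior. *)

Notation is_Cderive f z l :=
  (@is_derive C_AbsRing C_NormedModule (f : C -> C) (z%C : C) (l%C : C)).
Notation is_Pderive f t l :=
  (@is_derive R_AbsRing C_R_NormedModule (f : R -> C) (t : R) (l%C : C)).
Notation Pcontinuous f t :=
  (@continuous R_UniformSpace C_UniformSpace (f : R -> C) (t : R)).

(** Derivatives over C and along real paths live in different normed modules; the epsilon form is
    their common language, in which the chain rule between them can be proved. *)
Lemma is_Cderive_eps (f : C -> C) (z l : C) :
  is_Cderive f z l <->
  forall eps : R, 0 < eps -> exists d : R, 0 < d /\ forall w : C,
    Cmod (w - z) < d -> Cmod (f w - f z - l * (w - z)) <= eps * Cmod (w - z).
Proof.
split.
- intros [_ H] eps He.
  assert (Hz : is_filter_lim (locally (T:=AbsRing_UniformSpace C_AbsRing) z) z)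
    by (intros P HP; exact HP).
  specialize (H z Hz (mkposreal eps He)).
  destruct H as [d Hd].
  exists d; split; [apply cond_pos|].
  intros w Hw. specialize (Hd w Hw). simpl in Hd.
  change (Cmod (f w - f z - (w - z) * l) <= eps * Cmod (w - z)) in Hd.
  now replace (l * (w - z))%C with ((w - z) * l)%C by ring.
- intros H; split.
  { apply is_linear_scal_l. }
  intros x Hx.
  assert (E : z = x).
  { apply (is_filter_lim_locally_unique (K:=C_AbsRing) (V:=AbsRing_NormedModule C_AbsRing)). exact Hx. }
  subst x. intros eps.
  destruct (H eps (cond_pos eps)) as [d [Hd0 Hd]].
  exists (mkposreal d Hd0). intros w Hw. specialize (Hd w Hw).
  change (Cmod (f w - f z - (w - z) * l) <= eps * Cmod (w - z)).
  now replace ((w - z) * l)%C with (l * (w - z))%C by ring.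
Qed.

Lemma norm_C_R (z : C) : norm (V:=C_R_NormedModule) z = Cmod z.
Proof.
destruct z as [x y]. unfold norm; simpl. unfold prod_norm, Cmod; simpl.
unfold norm, abs; simpl. rewrite !Rmult_1_r. f_equal; f_equal; symmetry; apply Rsqr_abs.
Qed.

Lemma is_Pderive_eps (f : R -> C) (t : R) (l : C) :
  is_Pderive f t l <->
  forall eps : R, 0 < eps -> exists d : R, 0 < d /\ forall s : R,
    Rabs (s - t) < d -> Cmod (f s - f t - RtoC (s - t) * l) <= eps * Rabs (s - t).
Proof.
split.
- intros [_ H] eps He.
  assert (Hz : is_filter_lim (locally (T:=R_UniformSpace) t) t)
    by (intros P HP; exact HP).
  specialize (H t Hz (mkposreal eps He)).
  destruct H as [d Hd].
  exists d; split; [apply cond_pos|].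
  intros w Hw. specialize (Hd w Hw). simpl in Hd.
  rewrite norm_C_R, scal_R_Cmult in Hd. exact Hd.
- intros H; split.
  { apply (is_linear_scal_l (K:=R_AbsRing) (V:=C_R_NormedModule)). }
  intros x Hx.
  assert (E : t = x).
  { apply (is_filter_lim_locally_unique (K:=R_AbsRing) (V:=R_NormedModule)). exact Hx. }
  subst x. intros eps.
  destruct (H eps (cond_pos eps)) as [d [Hd0 Hd]].
  exists (mkposreal d Hd0). intros w Hw. specialize (Hd w Hw).
  rewrite norm_C_R, scal_R_Cmult. exact Hd.
Qed.

Lemma Pcontinuous_eps (f : R -> C) (t : R) :
  Pcontinuous f t <->
  forall eps : R, 0 < eps -> exists d : R, 0 < d /\ forall s : R,
    Rabs (s - t) < d -> Cmod (f s - f t) < eps.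
Proof.
unfold continuous. split.
- intros H eps He.
  assert (H1 : locally (T:=C_UniformSpace) (f t) (fun y => Cmod (y - f t) < eps)).
  { apply locally_C. now exists (mkposreal eps He). }
  destruct (H _ H1) as [d Hd].
  exists d; split; [apply cond_pos|]. exact Hd.
- intros H P HP. apply locally_C in HP. destruct HP as [e He].
  destruct (H e (cond_pos e)) as [d [Hd0 Hd]].
  exists (mkposreal d Hd0). intros s Hs. apply He. exact (Hd s Hs).
Qed.

Lemma Ccontinuous_of_ex_derive (f : C -> C) (z : C) : ex_derive f z ->
  forall eps : R, 0 < eps -> exists d : R, 0 < d /\ forall w : C,
    Cmod (w - z) < d -> Cmod (f w - f z) < eps.
Proof.
intros [l Hl] eps He.
destruct (proj1 (is_Cderive_eps f z l) Hl 1 Rlt_0_1) as [d [Hd0 Hd]].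
pose proof (Cmod_ge_0 l) as Hl0.
exists (Rmin d (eps / (2 + Cmod l))); split.
{ apply Rmin_pos; auto. apply Rdiv_lt_0_compat; lra. }
intros w Hw.
assert (H1 : Cmod (w - z) < d) by (eapply Rlt_le_trans; [exact Hw|apply Rmin_l]).
assert (H2 : Cmod (w - z) < eps / (2 + Cmod l)) by (eapply Rlt_le_trans; [exact Hw|apply Rmin_r]).
specialize (Hd w H1).
replace (f w - f z)%C with ((f w - f z - l * (w - z)) + l * (w - z))%C by ring.
eapply Rle_lt_trans; [apply Cmod_triangle|]. rewrite Cmod_mult.
apply (Rmult_lt_compat_r (2 + Cmod l)) in H2; [|lra].
unfold Rdiv in H2. rewrite Rmult_assoc, Rinv_l in H2; [|lra].
pose proof (Cmod_ge_0 (w - z)). nra.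
Qed.

Lemma Pcontinuous_mult (f g : R -> C) (t : R) :
  Pcontinuous f t -> Pcontinuous g t -> Pcontinuous (fun s => (f s * g s)%C) t.
Proof.
assert (E : forall h : R -> C, Pcontinuous h t <->
  @continuous R_UniformSpace (AbsRing_UniformSpace C_AbsRing) h t).
{ intros h; split; intros H P HP; apply H; now apply locally_C. }
rewrite !E. intros Hf Hg.
exact (continuous_mult (K:=C_AbsRing) f g t Hf Hg).
Qed.

Lemma Pcontinuous_of_Pderive (f : R -> C) (t : R) (l : C) :
  is_Pderive f t l -> Pcontinuous f t.
Proof.
intros H. apply (ex_derive_continuous (V:=C_R_NormedModule)). now exists l.
Qed.

Lemma is_Cderive_mult (f g : C -> C) (z df dg : C) :
  is_Cderive f z df -> is_Cderive g z dg ->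
  is_Cderive (fun w => f w * g w)%C z (df * g z + f z * dg)%C.
Proof.
(* The product rule is stated for [AbsRing_NormedModule C_AbsRing]. Its norm and operations agree
   with those of [C_NormedModule], so only the linearity component has to be rebuilt. *)
assert (E : forall (h : C -> C) l, is_Cderive h z l <->
  @is_derive C_AbsRing (AbsRing_NormedModule C_AbsRing) h z l).
{ intros h l; split; intros [H1 H2]; (split; [apply is_linear_scal_l|exact H2]). }
rewrite !E. intros Hf Hg.
apply (is_derive_mult (K:=C_AbsRing) f g z df dg Hf Hg).
intros; apply Cmult_comm.
Qed.

Lemma is_Cderive_plus (f g : C -> C) (z df dg : C) :
  is_Cderive f z df -> is_Cderive g z dg ->
  is_Cderive (fun w => f w + g w)%C z (df + dg)%C.
Proof. exact (is_derive_plus (V:=C_NormedModule) f g z df dg). Qed.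

Lemma is_Cderive_const (c z : C) : is_Cderive (fun _ => c) z 0%C.
Proof. exact (is_derive_const (V:=C_NormedModule) c z). Qed.

Lemma is_Cderive_id (z : C) : is_Cderive (fun w => w) z 1%C.
Proof.
apply is_Cderive_eps. intros eps He. exists 1; split; [lra|].
intros w _. replace (w - z - 1 * (w - z))%C with (RtoC 0) by ring.
rewrite Cmod_0. pose proof (Cmod_ge_0 (w - z)). nra.
Qed.

Lemma is_Cderive_eq (f : C -> C) (z l l' : C) :
  is_Cderive f z l -> l = l' -> is_Cderive f z l'.
Proof. now intros H <-. Qed.

Lemma is_Cderive_minus (f g : C -> C) (z df dg : C) :
  is_Cderive f z df -> is_Cderive g z dg ->
  is_Cderive (fun w => f w - g w)%C z (df - dg)%C.
Proof. exact (is_derive_minus (V:=C_NormedModule) f g z df dg). Qed.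

Lemma Cmod_minus_sym (x y : C) : Cmod (x - y) = Cmod (y - x).
Proof. rewrite <- Cmod_opp. f_equal. ring. Qed.

Lemma Cmod_triangle_rev (x y : C) : Cmod x - Cmod y <= Cmod (x - y).
Proof.
replace x with ((x - y) + y)%C at 1 by ring.
pose proof (Cmod_triangle (x - y) y). lra.
Qed.

Lemma is_Cderive_inv (z : C) : z <> 0%C -> is_Cderive (fun w => / w)%C z (- / (z * z))%C.
Proof.
intros Hz. apply is_Cderive_eps. intros eps He.
assert (Hz0 : 0 < Cmod z) by now apply Cmod_gt_0.
set (m := Cmod z) in *.
(* The first radius keeps |w| > m / 2; the second then bounds the exact remainder |w - z|^2 / (|w|
   m^2) by eps |w - z|. *)
exists (Rmin (m / 2) (eps * (m * m * m) / 2)); split.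
{ apply Rmin_pos; [lra|]. apply Rdiv_lt_0_compat; [|lra]. repeat apply Rmult_lt_0_compat; lra. }
intros w Hw.
assert (H1 : Cmod (w - z) < m / 2) by (eapply Rlt_le_trans; [exact Hw|apply Rmin_l]).
assert (H2 : Cmod (w - z) < eps * (m * m * m) / 2) by (eapply Rlt_le_trans; [exact Hw|apply Rmin_r]).
assert (H3 : m / 2 < Cmod w).
{ pose proof (Cmod_triangle_rev z w). rewrite Cmod_minus_sym in H. fold m in H. lra. }
assert (Hw0 : w <> 0%C) by (apply Cmod_gt_0; lra).
replace (/ w - / z - - / (z * z) * (w - z))%C with ((w - z) * (w - z) * / (w * (z * z)))%C
  by (field; split; auto).
rewrite !Cmod_mult, Cmod_inv, !Cmod_mult by (repeat apply Cmult_neq_0; auto).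
fold m. pose proof (Cmod_ge_0 (w - z)) as H0.
rewrite Rmult_assoc, Rmult_comm. apply Rmult_le_compat_r; auto.
apply (Rmult_le_reg_r (Cmod w * (m * m))).
{ repeat apply Rmult_lt_0_compat; lra. }
rewrite Rmult_assoc, Rinv_l, Rmult_1_r by (apply Rgt_not_eq; repeat apply Rmult_lt_0_compat; lra).
apply Rle_trans with (eps * (m / 2 * (m * m))); [nra|].
apply Rmult_le_compat_l; [lra|]. apply Rmult_le_compat_r; nra.
Qed.

Lemma is_Pderive_comp (f : C -> C) (g : R -> C) (t : R) (df dg : C) :
  is_Cderive f (g t) df -> is_Pderive g t dg -> is_Pderive (fun s => f (g s)) t (df * dg)%C.
Proof.
intros Hf Hg. apply is_Pderive_eps. intros eps He.
pose proof (Cmod_ge_0 df) as Hf0. pose proof (Cmod_ge_0 dg) as Hg0.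
(* Each tolerance pays for eps / 2. The cap 1 in [e2] also gives |g s - g t| <= (1 + |dg|) |s - t|,
   the factor that [e1] compensates. *)
set (e1 := eps / (2 * (1 + Cmod dg))).
set (e2 := Rmin 1 (eps / (2 * (1 + Cmod df)))).
assert (He1 : 0 < e1) by (apply Rdiv_lt_0_compat; lra).
assert (He2 : 0 < e2) by (apply Rmin_pos; [lra|apply Rdiv_lt_0_compat; lra]).
destruct (proj1 (is_Cderive_eps _ _ _) Hf e1 He1) as [d1 [Hd1 H1]].
destruct (proj1 (is_Pderive_eps _ _ _) Hg e2 He2) as [d2 [Hd2 H2]].
destruct (proj1 (Pcontinuous_eps _ _) (Pcontinuous_of_Pderive _ _ _ Hg) d1 Hd1) as [d3 [Hd3 H3]].
exists (Rmin d2 d3); split; [now apply Rmin_pos|]. intros s Hs.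
assert (S2 : Rabs (s - t) < d2) by (eapply Rlt_le_trans; [exact Hs|apply Rmin_l]).
assert (S3 : Rabs (s - t) < d3) by (eapply Rlt_le_trans; [exact Hs|apply Rmin_r]).
specialize (H1 (g s) (H3 s S3)). specialize (H2 s S2).
replace (f (g s) - f (g t) - RtoC (s - t) * (df * dg))%C with
 ((f (g s) - f (g t) - df * (g s - g t)) + df * (g s - g t - RtoC (s - t) * dg))%C by ring.
eapply Rle_trans; [apply Cmod_triangle|]. rewrite Cmod_mult.
assert (H4 : Cmod (g s - g t) <= (1 + Cmod dg) * Rabs (s - t)).
{ replace (g s - g t)%C with ((g s - g t - RtoC (s - t) * dg) + RtoC (s - t) * dg)%C by ring.
  eapply Rle_trans; [apply Cmod_triangle|]. rewrite Cmod_mult, Cmod_R.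
  assert (e2 <= 1) by apply Rmin_l. pose proof (Rabs_pos (s - t)). nra. }
assert (H5 : e2 * (1 + Cmod df) <= eps / 2).
{ apply Rle_trans with (eps / (2 * (1 + Cmod df)) * (1 + Cmod df)).
  - apply Rmult_le_compat_r; [lra|apply Rmin_r].
  - right; field; lra. }
assert (H6 : e1 * (1 + Cmod dg) = eps / 2) by (unfold e1; field; lra).
pose proof (Rabs_pos (s - t)) as Hp.
apply Rle_trans with (e1 * ((1 + Cmod dg) * Rabs (s - t)) + Cmod df * (e2 * Rabs (s - t))).
- apply Rplus_le_compat.
  + eapply Rle_trans; [exact H1|]. apply Rmult_le_compat_l; lra.
  + apply Rmult_le_compat_l; auto.
- assert (0 <= e2 * Rabs (s - t)) by nra. nra.
Qed.

Lemma is_Pderive_RtoC (t : R) : is_Pderive RtoC t 1%C.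
Proof.
apply is_Pderive_eps. intros eps He. exists 1; split; [lra|]. intros s _.
replace (RtoC s - RtoC t - RtoC (s - t) * 1)%C with (RtoC 0)
  by (rewrite RtoC_minus; ring).
rewrite Cmod_0. pose proof (Rabs_pos (s - t)). nra.
Qed.

Lemma is_Pderive_eq (f : R -> C) (t : R) (l l' : C) :
  is_Pderive f t l -> l = l' -> is_Pderive f t l'.
Proof. now intros H <-. Qed.

Lemma Cmod_le_abs (z : C) : Cmod z <= Rabs (Re z) + Rabs (Im z).
Proof.
destruct z as [x y]. unfold Re, Im; simpl.
replace (x, y) with (RtoC x + Ci * RtoC y)%C
  by (unfold Cplus, Cmult, RtoC, Ci; simpl; f_equal; ring).
eapply Rle_trans; [apply Cmod_triangle|].
rewrite Cmod_mult, !Cmod_R, Cmod_Ci. lra.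
Qed.

Lemma is_Pderive_pair (f g : R -> R) (t df dg : R) :
  is_derive f t df -> is_derive g t dg -> is_Pderive (fun s => (f s, g s)) t (df, dg).
Proof.
assert (E : forall (h : R -> R) dh, is_derive h t dh -> forall eps, 0 < eps ->
  exists d, 0 < d /\ forall s, Rabs (s - t) < d ->
    Rabs (h s - h t - (s - t) * dh) <= eps * Rabs (s - t)).
{ intros h dh [_ H] eps He.
  assert (Hz : is_filter_lim (locally (T:=R_UniformSpace) t) t)
    by (intros P HP; exact HP).
  destruct (H t Hz (mkposreal eps He)) as [d Hd].
  exists d; split; [apply cond_pos|]. exact Hd. }
intros Hf Hg. apply is_Pderive_eps. intros eps He.
destruct (E f df Hf (eps / 2) ltac:(lra)) as [d1 [Hd1 H1]].
destruct (E g dg Hg (eps / 2) ltac:(lra)) as [d2 [Hd2 H2]].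
exists (Rmin d1 d2); split; [now apply Rmin_pos|]. intros s Hs.
assert (S2 : Rabs (s - t) < d1) by (eapply Rlt_le_trans; [exact Hs|apply Rmin_l]).
assert (S3 : Rabs (s - t) < d2) by (eapply Rlt_le_trans; [exact Hs|apply Rmin_r]).
specialize (H1 s S2). specialize (H2 s S3).
eapply Rle_trans; [apply Cmod_le_abs|].
replace (Re _) with (f s - f t - (s - t) * df) by (simpl; ring).
replace (Im _) with (g s - g t - (s - t) * dg) by (simpl; ring). lra.
Qed.

Lemma is_derive_Re (f : R -> C) (t : R) (l : C) :
  is_Pderive f t l -> is_derive (fun s => Re (f s)) t (Re l).
Proof.
intros H. split; [apply is_linear_scal_l|]. intros x Hx.
assert (E : t = x).
{ apply (is_filter_lim_locally_unique (K:=R_AbsRing) (V:=R_NormedModule)). exact Hx. }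
subst x. intros eps.
destruct (proj1 (is_Pderive_eps _ _ _) H eps (cond_pos eps)) as [d [Hd0 Hd]].
exists (mkposreal d Hd0). intros s Hs. specialize (Hd s Hs).
eapply Rle_trans; [|exact Hd].
eapply Rle_trans; [|apply re_le_Cmod]. right.
change (Rabs (Re (f s) - Re (f t) - (s - t) * Re l) = Rabs (Re (f s - f t - RtoC (s - t) * l))).
f_equal. unfold Re, Im; simpl; ring.
Qed.

(** A complex path has no mean value equality, so it is projected on the direction w = f 1 - f 0:
    the real mean value theorem for Re (conj w * f) yields |w|^2 <= |w| K. *)
Lemma mean_value_path (f df : R -> C) (K : R) :
  (forall t, 0 <= t <= 1 -> is_Pderive f t (df t)) ->
  (forall t, 0 <= t <= 1 -> Cmod (df t) <= K) ->
  Cmod (f 1 - f 0) <= K.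
Proof.
intros Hd HK.
set (w := (f 1 - f 0)%C).
assert (HP : forall t, 0 <= t <= 1 ->
  is_derive (fun s => Re (Cconj w * f s)) t (Re (Cconj w * df t))).
{ intros t Ht. apply is_derive_Re.
  apply (is_Pderive_comp (fun z => Cconj w * z)%C f t (Cconj w) (df t)); [|now apply Hd].
  eapply is_Cderive_eq.
  - apply (is_Cderive_mult (fun _ => Cconj w) (fun z => z)); [apply is_Cderive_const|apply is_Cderive_id].
  - ring. }
destruct (MVT_gen (fun s => Re (Cconj w * f s)) 0 1 (fun t => Re (Cconj w * df t))) as [c [Hc1 Hc2]].
- rewrite Rmin_left, Rmax_right by lra. intros x Hx; apply HP; lra.
- rewrite Rmin_left, Rmax_right by lra. intros x Hx.
  apply continuity_pt_filterlim. apply (ex_derive_continuous (V:=R_NormedModule)).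
  exists (Re (Cconj w * df x)). now apply HP.
- rewrite Rmin_left, Rmax_right in Hc1 by lra.
  assert (E : Re (Cconj w * f 1%R) - Re (Cconj w * f 0%R) = Cmod w ^ 2).
  { rewrite Cmod2_alt. replace (Re (Cconj w * f 1%R) - Re (Cconj w * f 0%R)) with (Re (Cconj w * w)).
    - unfold Re, Im; simpl; ring.
    - unfold w, Re, Im; simpl; ring. }
  rewrite E in Hc2.
  assert (H1 : Re (Cconj w * df c) <= Cmod w * K).
  { eapply Rle_trans; [apply Rle_abs|]. eapply Rle_trans; [apply re_le_Cmod|].
    rewrite Cmod_mult, Cmod_conj. apply Rmult_le_compat_l; [apply Cmod_ge_0|now apply HK]. }
  destruct (Req_dec (Cmod w) 0) as [E0|E0].
  + rewrite E0. eapply Rle_trans; [apply Cmod_ge_0|apply (HK c Hc1)].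
  + pose proof (Cmod_ge_0 w). apply (Rmult_le_reg_l (Cmod w)); [lra|]. nra.
Qed.

(** * Goursat's lemma on cones *)

Notation PRInt f a b :=
  (@RInt C_R_CompleteNormedModule (f : R -> C) a b : C).
Notation is_PRInt f a b l :=
  (@is_RInt C_R_NormedModule (f : R -> C) a b (l%C : C)).

Lemma nested_intervals (x w : nat -> R) :
  (forall n, x n <= x (S n)) -> (forall n, x (S n) + w (S n) <= x n + w n) ->
  (forall n, 0 <= w n) -> exists p, forall n, x n <= p <= x n + w n.
Proof.
intros Hx Hw H0.
assert (Hle : forall m n, (m <= n)%nat -> x m <= x n).
{ induction 1; [lra|]. specialize (Hx m0). lra. }
assert (Hge : forall m n, (m <= n)%nat -> x n + w n <= x m + w m).
{ induction 1; [lra|]. specialize (Hw m0). lra. }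
assert (Hub : forall m n, x n <= x m + w m).
{ intros m n. destruct (Nat.le_ge_cases m n) as [H|H].
  - specialize (Hge m n H). specialize (H0 n). lra.
  - specialize (Hle n m H). specialize (H0 m). lra. }
destruct (completeness (fun y => exists n, y = x n)) as [p [Hp1 Hp2]].
- exists (x 0%nat + w 0%nat). intros y [n ->]. apply Hub.
- now exists (x 0%nat), 0%nat.
- exists p. intros n. split.
  + apply Hp1. now exists n.
  + apply Hp2. intros y [m ->]. apply Hub.
Qed.

(** [P] is an invariant of stage n and [Q] links consecutive stages. The bisection and both
    subsequence extractions are runs of this scheme. *)
Lemma dependent_choice {T : Type} (P : nat -> T -> Prop) (Q : nat -> T -> T -> Prop) (t0 : T) :
  P O t0 -> (forall n t, P n t -> exists t', P (S n) t' /\ Q n t t') ->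
  exists u : nat -> T, u O = t0 /\ forall n, P n (u n) /\ Q n (u n) (u (S n)).
Proof.
intros H0 HS.
assert (F : forall n (t : {t | P n t}), {t' : {t' | P (S n) t'} | Q n (proj1_sig t) (proj1_sig t')}).
{ intros n [t Ht]. destruct (constructive_indefinite_description _ (HS n t Ht)) as [t' [H1 H2]].
  now exists (exist _ t' H1). }
set (u := fix u n : {t | P n t} :=
  match n with O => exist _ t0 H0 | S m => proj1_sig (F m (u m)) end).
exists (fun n => proj1_sig (u n)). split; [reflexivity|]. intros n. split.
- exact (proj2_sig (u n)).
- exact (proj2_sig (F n (u n))).
Qed.

(* Bisection: one quarter of a rectangle carries at least a quarter of the value, which contradicts the quadratic local estimate at the limit point. *)
Lemma additive_rectangle_zero (I : R -> R -> R -> R -> C) (A B Y Z : R) :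
  A <= B -> Y <= Z ->
  (forall a m b c d, A <= a <= m -> m <= b <= B -> Y <= c <= d -> d <= Z ->
     I a b c d = (I a m c d + I m b c d)%C) ->
  (forall a b c m d, A <= a <= b -> b <= B -> Y <= c <= m -> m <= d <= Z ->
     I a b c d = (I a b c m + I a b m d)%C) ->
  (forall p q, A <= p <= B -> Y <= q <= Z -> forall eps, 0 < eps ->
     exists delta, 0 < delta /\ forall a b c d,
       A <= a <= p -> p <= b <= B -> Y <= c <= q -> q <= d <= Z ->
       b - a < delta -> d - c < delta ->
       Cmod (I a b c d) <= eps * ((b - a) + (d - c)) ^ 2) ->
  I A B Y Z = 0%C.
Proof.
intros HAB HYZ Hadd1 Hadd2 Hloc.
destruct (Req_dec (Cmod (I A B Y Z)) 0) as [E|E]; [now apply Cmod_eq_0|exfalso].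
set (c := Cmod (I A B Y Z)) in *.
assert (Hc : 0 < c) by (pose proof (Cmod_ge_0 (I A B Y Z)); fold c in H; lra).
set (w := fun n => (B - A) / 2 ^ n). set (h := fun n => (Z - Y) / 2 ^ n).
assert (Hp : forall n, 0 < 2 ^ n) by (intros; apply pow_lt; lra).
assert (Hw0 : forall n, 0 <= w n).
{ intros n. apply Rmult_le_pos; [lra|]. left. now apply Rinv_0_lt_compat. }
assert (Hh0 : forall n, 0 <= h n).
{ intros n. apply Rmult_le_pos; [lra|]. left. now apply Rinv_0_lt_compat. }
assert (HwS : forall n, w n = w (S n) + w (S n)).
{ intros n. unfold w. simpl. field. apply Rgt_not_eq, Hp. }
assert (HhS : forall n, h n = h (S n) + h (S n)).
{ intros n. unfold h. simpl. field. apply Rgt_not_eq, Hp. }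
set (P := fun n (t : R * R) => A <= fst t /\ fst t + w n <= B /\ Y <= snd t /\ snd t + h n <= Z /\
  c / 4 ^ n <= Cmod (I (fst t) (fst t + w n) (snd t) (snd t + h n))).
set (Q := fun n (t t' : R * R) => fst t <= fst t' /\ fst t' + w (S n) <= fst t + w n /\
  snd t <= snd t' /\ snd t' + h (S n) <= snd t + h n).
destruct (dependent_choice P Q (A, Y)) as [u [Hu0 Hu]].
- unfold P, w, h; simpl. rewrite !Rdiv_1_r.
  replace (A + (B - A)) with B by ring. replace (Y + (Z - Y)) with Z by ring.
  fold c. lra.
- intros n [x y] (H1 & H2 & H3 & H4 & H5); simpl in *.
  pose proof (Hw0 (S n)) as Hw1. pose proof (Hh0 (S n)) as Hh1.
  pose proof (HwS n) as Hw2. pose proof (HhS n) as Hh2.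
  set (w' := w (S n)) in *. set (h' := h (S n)) in *.
  rewrite (Hadd1 x (x + w') (x + w n) y (y + h n)) in H5 by lra.
  rewrite (Hadd2 x (x + w') y (y + h') (y + h n)) in H5 by lra.
  rewrite (Hadd2 (x + w') (x + w n) y (y + h') (y + h n)) in H5 by lra.
  replace (x + w n) with (x + w' + w') in H5 by lra.
  replace (y + h n) with (y + h' + h') in H5 by lra.
  assert (E4 : c / 4 ^ n = 4 * (c / (4 * 4 ^ n))) by (field; apply Rgt_not_eq, pow_lt; lra).
  assert (Hstep : forall t, P (S n) t -> Q n (x, y) t -> exists t', P (S n) t' /\ Q n (x, y) t')
    by (intros t; now exists t).
  destruct (Rle_dec (c / 4 ^ S n) (Cmod (I x (x + w') y (y + h')))) as [D1|D1].
  { apply (Hstep (x, y)); unfold P, Q; simpl; fold w' h'; simpl in D1; lra. }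
  destruct (Rle_dec (c / 4 ^ S n) (Cmod (I x (x + w') (y + h') (y + h' + h')))) as [D2|D2].
  { apply (Hstep (x, y + h')); unfold P, Q; simpl; fold w' h'; simpl in D2; lra. }
  destruct (Rle_dec (c / 4 ^ S n) (Cmod (I (x + w') (x + w' + w') y (y + h')))) as [D3|D3].
  { apply (Hstep (x + w', y)); unfold P, Q; simpl; fold w' h'; simpl in D3; lra. }
  destruct (Rle_dec (c / 4 ^ S n) (Cmod (I (x + w') (x + w' + w') (y + h') (y + h' + h')))) as [D4|D4].
  { apply (Hstep (x + w', y + h')); unfold P, Q; simpl; fold w' h'; simpl in D4; lra. }
  exfalso. simpl in D1, D2, D3, D4. revert H5. apply Rlt_not_le.
  eapply Rle_lt_trans; [apply Cmod_triangle|].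
  pose proof (Cmod_triangle (I x (x + w') y (y + h')) (I x (x + w') (y + h') (y + h' + h'))).
  pose proof (Cmod_triangle (I (x + w') (x + w' + w') y (y + h')) (I (x + w') (x + w' + w') (y + h') (y + h' + h'))).
  lra.
- destruct (nested_intervals (fun n => fst (u n)) w) as [p Hpp]; auto.
  { intros n; apply (Hu n). } { intros n; apply (Hu n). }
  destruct (nested_intervals (fun n => snd (u n)) h) as [q Hqq]; auto.
  { intros n; apply (Hu n). } { intros n; apply (Hu n). }
  assert (Hpb : A <= p <= B).
  { destruct (Hu O) as [(H1 & H2 & _) _]. specialize (Hpp O). lra. }
  assert (Hqb : Y <= q <= Z).
  { destruct (Hu O) as [(_ & _ & H1 & H2 & _) _]. specialize (Hqq O). lra. }
  set (S0 := (B - A) + (Z - Y)).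
  assert (HS0 : 0 <= S0) by (unfold S0; lra).
  (* At stage n the two side lengths add up to S0 / 2^n; with this constant the quadratic estimate
     gives less than c / 4^n, against the invariant. *)
  destruct (Hloc p q Hpb Hqb (c / (2 * (1 + S0 ^ 2)))) as [delta [Hd0 Hd]].
  { apply Rdiv_lt_0_compat; nra. }
  assert (HN : exists n, S0 / 2 ^ n < delta).
  { destruct (pow_lt_1_zero (/ 2) ltac:(rewrite Rabs_pos_eq; lra) (delta / (1 + S0)) ltac:(apply Rdiv_lt_0_compat; lra)) as [N HN].
    - exists N. specialize (HN N (le_n _)). rewrite pow_inv, Rabs_pos_eq in HN.
      + apply Rle_lt_trans with ((1 + S0) * / 2 ^ N).
        * apply Rmult_le_compat_r; [left; now apply Rinv_0_lt_compat|lra].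
        * apply (Rmult_lt_compat_l (1 + S0)) in HN; [|lra].
          replace ((1 + S0) * (delta / (1 + S0))) with delta in HN by (field; lra). exact HN.
      + left; now apply Rinv_0_lt_compat. }
  destruct HN as [n Hn].
  destruct (Hu n) as [(H1 & H2 & H3 & H4 & H5) _].
  specialize (Hpp n). specialize (Hqq n). simpl in Hpp, Hqq.
  assert (ES : w n + h n = S0 / 2 ^ n) by (unfold w, h, S0; field; apply Rgt_not_eq, Hp).
  pose proof (Hw0 n). pose proof (Hh0 n).
  specialize (Hd (fst (u n)) (fst (u n) + w n) (snd (u n)) (snd (u n) + h n)).
  assert (Hd' := Hd ltac:(lra) ltac:(lra) ltac:(lra) ltac:(lra) ltac:(lra) ltac:(lra)).
  replace (fst (u n) + w n - fst (u n) + (snd (u n) + h n - snd (u n))) with (S0 / 2 ^ n) in Hd' by lra.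
  assert (E4 : 4 ^ n = 2 ^ n * 2 ^ n) by (rewrite <- Rpow_mult_distr; f_equal; lra).
  assert (Hfin : c / 4 ^ n <= c / (2 * (1 + S0 ^ 2)) * (S0 / 2 ^ n) ^ 2) by lra.
  replace (c / (2 * (1 + S0 ^ 2)) * (S0 / 2 ^ n) ^ 2)
    with ((c * (S0 ^ 2 / (2 * (1 + S0 ^ 2)))) / 4 ^ n) in Hfin
    by (rewrite E4; field; split; [apply Rgt_not_eq, Hp|apply Rgt_not_eq; nra]).
  assert (HX : S0 ^ 2 / (2 * (1 + S0 ^ 2)) < 1) by (apply Rlt_div_l; nra).
  assert (0 < / 4 ^ n) by (apply Rinv_0_lt_compat, pow_lt; lra).
  assert (c <= c * (S0 ^ 2 / (2 * (1 + S0 ^ 2)))) by (eapply Rmult_le_reg_r; [exact H6|exact Hfin]).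
  nra.
Qed.

Lemma Pcontinuous_comp (L : C -> C) (g : R -> C) (t : R) :
  ex_derive L (g t) -> Pcontinuous g t -> Pcontinuous (fun s => L (g s)) t.
Proof.
intros HL Hg. apply Pcontinuous_eps. intros eps He.
destruct (Ccontinuous_of_ex_derive L (g t) HL eps He) as [d1 [Hd1 H1]].
destruct (proj1 (Pcontinuous_eps _ _) Hg d1 Hd1) as [d [Hd H2]].
exists d; split; auto.
Qed.

Lemma ex_PRInt_continuous (f : R -> C) (a b : R) : a <= b ->
  (forall t, a <= t <= b -> Pcontinuous f t) ->
  is_PRInt f a b (PRInt f a b).
Proof.
intros Hab H. apply (RInt_correct (V:=C_R_CompleteNormedModule)).
apply (ex_RInt_continuous (V:=C_R_CompleteNormedModule)).
rewrite Rmin_left, Rmax_right by lra. exact H.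
Qed.

Lemma is_PRInt_derive (f df : R -> C) (a b : R) : a <= b ->
  (forall t, a <= t <= b -> is_Pderive f t (df t)) ->
  (forall t, a <= t <= b -> Pcontinuous df t) ->
  is_PRInt df a b (f b - f a).
Proof.
intros Hab H1 H2.
apply (is_RInt_derive (V:=C_R_CompleteNormedModule) f df a b);
  rewrite Rmin_left, Rmax_right by lra; assumption.
Qed.

Lemma Cmod_PRInt_le (f : R -> C) (a b M : R) (l : C) : a <= b ->
  (forall t, a <= t <= b -> Cmod (f t) <= M) -> is_PRInt f a b l -> Cmod l <= (b - a) * M.
Proof.
intros Hab HM Hl. rewrite <- norm_C_R.
apply (norm_RInt_le_const (V:=C_R_NormedModule) f a b l M); auto.
intros t Ht. rewrite norm_C_R. now apply HM.
Qed.

Lemma is_PRInt_minus (f g : R -> C) (a b : R) (lf lg : C) :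
  is_PRInt f a b lf -> is_PRInt g a b lg -> is_PRInt (fun t => f t - g t)%C a b (lf - lg).
Proof. exact (is_RInt_minus (V:=C_R_NormedModule) f g a b lf lg). Qed.

(** The part of the integrand that has a primitive contributes only endpoint values, which cancel
    around a closed boundary; what survives is the approximation error m times the speed K. *)
Lemma path_integral_near_exact (L P p : C -> C) (g dg : R -> C) (c d m K : R) : c <= d ->
  (forall t, c <= t <= d -> is_Pderive g t (dg t)) ->
  (forall t, c <= t <= d -> Pcontinuous dg t) ->
  (forall t, c <= t <= d -> ex_derive L (g t)) ->
  (forall z, is_Cderive P z (p z)) -> (forall z, @ex_derive C_AbsRing C_NormedModule p z) ->
  (forall t, c <= t <= d -> Cmod (L (g t) - p (g t)) <= m) ->
  (forall t, c <= t <= d -> Cmod (dg t) <= K) ->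
  Cmod (PRInt (fun t => L (g t) * dg t)%C c d - (P (g d) - P (g c))) <= (d - c) * (m * K).
Proof.
intros Hcd Hg Hdg HL HP Hp Hm HK.
assert (Hgc : forall t, c <= t <= d -> Pcontinuous g t).
{ intros t Ht. eapply Pcontinuous_of_Pderive, Hg, Ht. }
apply Cmod_PRInt_le with (f := fun t => (L (g t) * dg t - p (g t) * dg t)%C); auto.
- intros t Ht. replace (L (g t) * dg t - p (g t) * dg t)%C with ((L (g t) - p (g t)) * dg t)%C by ring.
  rewrite Cmod_mult. apply Rmult_le_compat; auto using Cmod_ge_0.
- apply is_PRInt_minus.
  + apply ex_PRInt_continuous; auto. intros t Ht.
    apply Pcontinuous_mult; auto. apply Pcontinuous_comp; auto.
  + apply (is_PRInt_derive (fun t => P (g t))); auto.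
    * intros t Ht. apply is_Pderive_comp; auto.
    * intros t Ht. apply Pcontinuous_mult; auto. apply Pcontinuous_comp; auto.
Qed.

Lemma PRInt_Chasles (f : R -> C) (a b c : R) : a <= b -> b <= c ->
  (forall t, a <= t <= c -> Pcontinuous f t) ->
  PRInt f a c = (PRInt f a b + PRInt f b c)%C.
Proof.
intros Hab Hbc H. symmetry.
apply (RInt_Chasles (V:=C_R_CompleteNormedModule));
  apply (ex_RInt_continuous (V:=C_R_CompleteNormedModule));
  rewrite Rmin_left, Rmax_right by lra; intros t Ht; apply H; lra.
Qed.

Lemma is_Cderive_affine (a b z : C) : is_Cderive (fun w => a + b * w)%C z b.
Proof.
eapply is_Cderive_eq.
- apply is_Cderive_plus; [apply is_Cderive_const|].
  apply (is_Cderive_mult (fun _ => b) (fun w => w)); [apply is_Cderive_const|apply is_Cderive_id].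
- ring.
Qed.

Lemma is_Cderive_quadratic (l0 l1 z0 z : C) :
  is_Cderive (fun w => l0 * w + RtoC (/ 2) * l1 * ((w - z0) * (w - z0)))%C z (l0 + l1 * (z - z0)).
Proof.
eapply is_Cderive_eq.
- apply is_Cderive_plus.
  + apply (is_Cderive_mult (fun _ => l0) (fun w => w)); [apply is_Cderive_const|apply is_Cderive_id].
  + apply (is_Cderive_mult (fun _ => RtoC (/ 2) * l1)%C (fun w => (w - z0) * (w - z0))%C).
    * apply is_Cderive_const.
    * apply (is_Cderive_mult (fun w => w - z0)%C (fun w => w - z0)%C);
        (apply is_Cderive_minus; [apply is_Cderive_id|apply is_Cderive_const]).
- simpl.
  replace (RtoC (/ 2)) with (/ (1 + 1))%C.
  + field.
  + rewrite <- RtoC_plus, <- RtoC_inv by lra. f_equal.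
Qed.

Section Cone.
Variables (L : C -> C) (a : C) (e de : R -> C) (K A : R).
Hypothesis HA : 0 <= A <= 1.
Hypothesis He : forall t, is_Pderive e t (de t).
Hypothesis Hde : forall t, Pcontinuous de t.
Hypothesis HeK : forall t, Cmod (e t) <= K.
Hypothesis HdeK : forall t, Cmod (de t) <= K.
Hypothesis HeL : forall s t, Cmod (e s - e t) <= K * Rabs (s - t).
Hypothesis HL : forall s t, A <= s <= 1 -> ex_derive L (a + RtoC s * e t)%C.

(** [hor] and [ver] are the two components of the form L dz pulled back by (s, t) -> a + s e(t): one
    along t at fixed s, the other along s at fixed t. *)
Let hor (s t : R) : C := (L (a + RtoC s * e t) * (RtoC s * de t))%C.
Let ver (t s : R) : C := (L (a + e t * RtoC s) * e t)%C.

Let hor_cont s t : A <= s <= 1 -> Pcontinuous (hor s) t.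
Proof.
intros Hs. apply Pcontinuous_mult.
- apply (Pcontinuous_comp L (fun t => a + RtoC s * e t)%C); [now apply HL|].
  eapply Pcontinuous_of_Pderive, (is_Pderive_comp (fun z => a + RtoC s * z)%C); [apply is_Cderive_affine|apply He].
- apply Pcontinuous_mult; auto. apply (Pcontinuous_of_Pderive _ _ 0%C).
  apply (is_derive_const (V:=C_R_NormedModule)).
Qed.

Let ver_cont t s : A <= s <= 1 -> Pcontinuous (ver t) s.
Proof.
intros Hs. apply Pcontinuous_mult.
- apply (Pcontinuous_comp L (fun s => a + e t * RtoC s)%C).
  + replace (a + e t * RtoC s)%C with (a + RtoC s * e t)%C by ring. now apply HL.
  + eapply Pcontinuous_of_Pderive, (is_Pderive_comp (fun z => a + e t * z)%C); [apply is_Cderive_affine|apply is_Pderive_RtoC].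
- apply (Pcontinuous_of_Pderive _ _ 0%C). apply (is_derive_const (V:=C_R_NormedModule)).
Qed.

Let bnd (s1 s2 t1 t2 : R) : C :=
  (PRInt (hor s1) t1 t2 + PRInt (ver t2) s1 s2 - PRInt (hor s2) t1 t2 - PRInt (ver t1) s1 s2)%C.

(** Near a point z0 of the cone, L is its tangent affine map up to a small relative error. That map
    has a quadratic primitive, so a small boundary integral sees only the error. Since s stays above
    [A], L may be singular at the apex a when [A] is positive. *)
Lemma goursat_cone (t1 t2 : R) : t1 <= t2 ->
  (PRInt (fun t => L (a + RtoC A * e t) * (RtoC A * de t))%C t1 t2
   + PRInt (fun s => L (a + e t2 * RtoC s) * e t2)%C A 1
   - PRInt (fun t => L (a + RtoC 1 * e t) * (RtoC 1 * de t))%C t1 t2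
   - PRInt (fun s => L (a + e t1 * RtoC s) * e t1)%C A 1 = 0)%C.
Proof.
intros Ht12.
apply (additive_rectangle_zero bnd A 1 t1 t2); try lra.
- intros s1 m s2 c d H1 H2 H3 H4. unfold bnd.
  rewrite (PRInt_Chasles (ver d) s1 m s2), (PRInt_Chasles (ver c) s1 m s2);
    try lra; try (intros; apply ver_cont; lra). ring.
- intros s1 s2 c m d H1 H2 H3 H4. unfold bnd.
  rewrite (PRInt_Chasles (hor s1) c m d), (PRInt_Chasles (hor s2) c m d);
    try lra; try (intros; apply hor_cont; lra). ring.
- intros p q Hp Hq eps Heps.
  assert (HK0 : 0 <= K) by (eapply Rle_trans; [apply Cmod_ge_0|apply (HeK 0)]).
  set (z0 := (a + RtoC p * e q)%C).
  destruct (HL p q Hp) as [l1 Hl1]. fold z0 in Hl1.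
  (* With D = (s2 - s1) + (d - c), the parameter lengths of the four sides add up to 2 D, the
     integrand error is at most eta K D and the speed at most K: in total 2 K^2 eta D^2 <= eps
     D^2. *)
  set (eta := eps / (2 * (1 + K * K))).
  assert (Heta : 0 < eta) by (apply Rdiv_lt_0_compat; nra).
  destruct (proj1 (is_Cderive_eps L z0 l1) Hl1 eta Heta) as [r [Hr0 Hr]].
  exists (r / (2 * (1 + K))). split; [apply Rdiv_lt_0_compat; lra|].
  intros s1 s2 c d H1 H2 H3 H4 H5 H6.
  set (P := fun w : C => (L z0 * w + RtoC (/ 2) * l1 * ((w - z0) * (w - z0)))%C).
  set (dP := fun w : C => (L z0 + l1 * (w - z0))%C).
  assert (HP : forall z, is_Cderive P z (dP z)) by (intros; apply is_Cderive_quadratic).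
  assert (HdP : forall z, @ex_derive C_AbsRing C_NormedModule dP z).
  { intros z. exists l1. eapply is_Cderive_eq.
    - apply is_Cderive_plus; [apply is_Cderive_const|].
      apply (is_Cderive_mult (fun _ => l1) (fun w => w - z0)%C); [apply is_Cderive_const|].
      apply is_Cderive_minus; [apply is_Cderive_id|apply is_Cderive_const].
    - ring. }
  set (D := (s2 - s1) + (d - c)).
  assert (Hdist : forall s t, s1 <= s <= s2 -> c <= t <= d -> Cmod (a + RtoC s * e t - z0) <= K * D).
  { intros s t Hs Ht. unfold z0, D.
    replace (a + RtoC s * e t - (a + RtoC p * e q))%C
      with (RtoC (s - p) * e t + RtoC p * (e t - e q))%C by (rewrite RtoC_minus; ring).
    eapply Rle_trans; [apply Cmod_triangle|]. rewrite !Cmod_mult, !Cmod_R, (Rabs_pos_eq p) by lra.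
    assert (Rabs (s - p) <= s2 - s1) by (apply Rabs_le; lra).
    assert (Rabs (t - q) <= d - c) by (apply Rabs_le; lra).
    pose proof (HeK t). pose proof (HeL t q). pose proof (Cmod_ge_0 (e t)).
    pose proof (Cmod_ge_0 (e t - e q)). pose proof (Rabs_pos (s - p)).
    assert (Rabs (s - p) * Cmod (e t) <= (s2 - s1) * K) by (apply Rmult_le_compat; lra).
    assert (K * Rabs (t - q) <= K * (d - c)) by (apply Rmult_le_compat_l; lra).
    nra. }
  assert (HDr : K * D < r).
  { assert (D * (1 + K) < r).
    { unfold D. assert (r / (2 * (1 + K)) * (1 + K) = r / 2) by (field; lra). nra. }
    unfold D in *. nra. }
  assert (HLP : forall s t, s1 <= s <= s2 -> c <= t <= d ->
    Cmod (L (a + RtoC s * e t) - dP (a + RtoC s * e t)%C) <= eta * (K * D)).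
  { intros s t Hs Ht. specialize (Hdist s t Hs Ht).
    assert (Hlt : Cmod (a + RtoC s * e t - z0) < r) by lra.
    specialize (Hr _ Hlt). unfold dP.
    replace (L (a + RtoC s * e t) - (L z0 + l1 * (a + RtoC s * e t - z0)))%C
      with (L (a + RtoC s * e t) - L z0 - l1 * (a + RtoC s * e t - z0))%C by ring.
    eapply Rle_trans; [exact Hr|]. apply Rmult_le_compat_l; lra. }
  assert (Hh : forall s, s1 <= s <= s2 ->
    Cmod (PRInt (hor s) c d - (P (a + RtoC s * e d)%C - P (a + RtoC s * e c)%C))%C
      <= (d - c) * (eta * (K * D) * K)).
  { intros s Hs. unfold hor.
    apply (path_integral_near_exact L P dP (fun t => a + RtoC s * e t)%C (fun t => RtoC s * de t)%C); auto; try lra.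
    - intros t Ht. apply (is_Pderive_comp (fun z => a + RtoC s * z)%C e); [apply is_Cderive_affine|apply He].
    - intros t Ht. apply Pcontinuous_mult; auto. apply (Pcontinuous_of_Pderive _ _ 0%C).
      apply (is_derive_const (V:=C_R_NormedModule)).
    - intros t Ht. apply HL. lra.
    - intros t Ht. rewrite Cmod_mult, Cmod_R, Rabs_pos_eq by lra.
      pose proof (HdeK t). pose proof (Cmod_ge_0 (de t)). nra. }
  assert (Hv : forall t, c <= t <= d ->
    Cmod (PRInt (ver t) s1 s2 - (P (a + e t * RtoC s2)%C - P (a + e t * RtoC s1)%C))%C
      <= (s2 - s1) * (eta * (K * D) * K)).
  { intros t Ht. unfold ver.
    apply (path_integral_near_exact L P dP (fun s => a + e t * RtoC s)%C (fun _ => e t)); auto; try lra.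
    - intros s Hs. eapply is_Pderive_eq.
      + apply (is_Pderive_comp (fun z => a + e t * z)%C RtoC); [apply is_Cderive_affine|apply is_Pderive_RtoC].
      + ring.
    - intros s Hs. apply (Pcontinuous_of_Pderive _ _ 0%C).
      apply (is_derive_const (V:=C_R_NormedModule)).
    - intros s Hs. replace (a + e t * RtoC s)%C with (a + RtoC s * e t)%C by ring. apply HL; lra.
    - intros s Hs. replace (a + e t * RtoC s)%C with (a + RtoC s * e t)%C by ring. apply HLP; lra. }
  pose proof (Hh s1 ltac:(lra)) as B1. pose proof (Hh s2 ltac:(lra)) as B2.
  pose proof (Hv c ltac:(lra)) as B3. pose proof (Hv d ltac:(lra)) as B4.
  (* This gives the corners the same form on vertical and horizontal sides, so that the values of
     the primitive [P] cancel. *)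
  rewrite (Cmult_comm (e c)), (Cmult_comm (e c)) in B3.
  rewrite (Cmult_comm (e d)), (Cmult_comm (e d)) in B4.
  unfold bnd.
  match type of B1 with Cmod ?x <= _ => set (X1 := x) in * end.
  match type of B2 with Cmod ?x <= _ => set (X2 := x) in * end.
  match type of B3 with Cmod ?x <= _ => set (X3 := x) in * end.
  match type of B4 with Cmod ?x <= _ => set (X4 := x) in * end.
  replace (PRInt (hor s1) c d + PRInt (ver d) s1 s2 - PRInt (hor s2) c d - PRInt (ver c) s1 s2)%C
    with ((X1 + X4) - (X2 + X3))%C by (unfold X1, X2, X3, X4; ring).
  pose proof (Cmod_triangle (X1 + X4) (- (X2 + X3))) as T1. rewrite Cmod_opp in T1.
  pose proof (Cmod_triangle X1 X4). pose proof (Cmod_triangle X2 X3).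
  unfold Cminus. fold D.
  assert (EE : eta * (2 * (1 + K * K)) = eps) by (unfold eta; field; apply Rgt_not_eq; nra).
  assert (HD : 0 <= D) by (unfold D; lra).
  assert (Cmod (X1 + X4 + - (X2 + X3)) <= 2 * D * (eta * (K * D) * K)) by (unfold D in *; lra).
  assert (2 * D * (eta * (K * D) * K) <= eps * D ^ 2).
  { rewrite <- EE. assert (0 <= eta * (D * D)) by nra. nra. }
  lra.
Qed.
End Cone.

(** * Cauchy's formula on circles *)

Definition circ (r t : R) : C := (r * cos t, r * sin t).

Lemma is_Pderive_circ (r t : R) : is_Pderive (circ r) t (Ci * circ r t).
Proof.
eapply is_Pderive_eq.
- apply (is_Pderive_pair (fun t => r * cos t) (fun t => r * sin t)); auto_derive; auto; reflexivity.
- unfold circ, Ci, Cmult; simpl; f_equal; ring.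
Qed.

Lemma Cmod_circ (r t : R) : 0 <= r -> Cmod (circ r t) = r.
Proof.
intros Hr. unfold Cmod, circ; simpl.
pose proof (sin2_cos2 t) as E. unfold Rsqr in E.
replace (_ + _) with (r * r) by nra. now apply sqrt_square.
Qed.

Lemma circ_lipschitz (r s t : R) : 0 <= r -> Cmod (circ r s - circ r t) <= r * Rabs (s - t).
Proof.
intros Hr.
set (g := fun u => circ r (t + u * (s - t))).
replace (circ r s) with (g 1) by (unfold g; f_equal; ring).
replace (circ r t) with (g 0) by (unfold g; f_equal; ring).
apply mean_value_path with (df := fun u => (Ci * circ r (t + u * (s - t)) * RtoC (s - t))%C).
- intros u _. eapply is_Pderive_eq.
  + apply (is_Pderive_pair (fun u => r * cos (t + u * (s - t))) (fun u => r * sin (t + u * (s - t))));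
      auto_derive; auto; reflexivity.
  + unfold circ, Ci, Cmult, RtoC; simpl; f_equal; ring.
- intros u _. rewrite !Cmod_mult, Cmod_Ci, Cmod_circ, Cmod_R by auto. lra.
Qed.

Lemma Pcontinuous_const (c : C) (t : R) : Pcontinuous (fun _ => c) t.
Proof. apply (Pcontinuous_of_Pderive _ _ 0%C), (is_derive_const (V:=C_R_NormedModule)). Qed.

Lemma Pcontinuous_circ (r t : R) : Pcontinuous (circ r) t.
Proof. eapply Pcontinuous_of_Pderive, is_Pderive_circ. Qed.

Lemma Rle_zero_of_small (x K : R) : (forall eps, 0 < eps -> x <= K * eps) -> x <= 0.
Proof.
intros H. destruct (Rle_lt_dec x 0) as [|Hx]; auto.
set (K' := Rmax K 1).
assert (HK : K <= K' /\ 1 <= K') by (split; [apply Rmax_l|apply Rmax_r]).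
clearbody K'. destruct HK as [HK1 HK2].
assert (He : 0 < x / (2 * K')) by (apply Rdiv_lt_0_compat; lra).
specialize (H _ He).
assert (K * (x / (2 * K')) <= K' * (x / (2 * K'))) by (apply Rmult_le_compat_r; lra).
replace (K' * (x / (2 * K'))) with (x / 2) in H0 by (field; lra). lra.
Qed.

Lemma ex_Cderive_mult (f g : C -> C) (z : C) :
  @ex_derive C_AbsRing C_NormedModule f z -> @ex_derive C_AbsRing C_NormedModule g z ->
  @ex_derive C_AbsRing C_NormedModule (fun w => f w * g w)%C z.
Proof. intros [l Hl] [m Hm]. eexists. exact (is_Cderive_mult _ _ _ _ _ Hl Hm). Qed.

Lemma ex_Cderive_inv_minus (a z : C) : z <> a ->
  @ex_derive C_AbsRing C_NormedModule (fun w => / (w - a))%C z.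
Proof.
intros Hz. exists (- / ((z - a) * (z - a)) * (1 - 0))%C.
assert (Hza : (z - a)%C <> 0%C) by now apply Cminus_eq_contra.
pose proof (is_Cderive_inv (z - a) Hza) as H1.
pose proof (is_Cderive_minus _ _ z _ _ (is_Cderive_id z) (is_Cderive_const a z)) as H2.
apply is_Cderive_eps. intros eps Heps.
destruct (proj1 (is_Cderive_eps _ _ _) H1 eps Heps) as [d [Hd0 Hd]].
exists d; split; auto. intros w Hw.
specialize (Hd (w - a)%C).
replace (w - a - (z - a))%C with (w - z)%C in Hd by ring.
replace (- / ((z - a) * (z - a)) * (1 - 0))%C with (- / ((z - a) * (z - a)))%C by ring.
now apply Hd.
Qed.

Lemma PRInt_ext (f g : R -> C) (a b : R) : a <= b ->
  (forall t, a <= t <= b -> f t = g t) -> PRInt f a b = PRInt g a b.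
Proof.
intros Hab H. apply (RInt_ext (V:=C_R_CompleteNormedModule)).
rewrite Rmin_left, Rmax_right by lra. intros t Ht. apply H; lra.
Qed.

(** The integral is taken over C as a real module, where linearity covers real scalars; a complex
    factor is therefore treated on the two coordinates. *)
Lemma PRInt_Cmult (c : C) (f : R -> C) (a b : R) : a <= b ->
  (forall t, a <= t <= b -> Pcontinuous f t) ->
  PRInt (fun t => c * f t)%C a b = (c * PRInt f a b)%C.
Proof.
intros Hab Hf. apply (is_RInt_unique (V:=C_R_CompleteNormedModule)).
pose proof (ex_PRInt_continuous f a b Hab Hf) as H0.
set (l := PRInt f a b) in *.
destruct l as [lx ly]. destruct c as [u v].
pose proof (is_RInt_fct_extend_fst (U:=R_NormedModule) (V:=R_NormedModule) f _ _ _ H0) as Hx.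
pose proof (is_RInt_fct_extend_snd (U:=R_NormedModule) (V:=R_NormedModule) f _ _ _ H0) as Hy.
simpl in Hx, Hy.
apply (is_RInt_fct_extend_pair (U:=R_NormedModule) (V:=R_NormedModule)); simpl.
- exact (is_RInt_minus _ _ _ _ _ _ (is_RInt_scal _ _ _ u _ Hx) (is_RInt_scal _ _ _ v _ Hy)).
- exact (is_RInt_plus _ _ _ _ _ _ (is_RInt_scal _ _ _ u _ Hy) (is_RInt_scal _ _ _ v _ Hx)).
Qed.

(** * The Cauchy kernel on a circle *)

Section Circle.
Variables (a : C) (r : R).
Hypothesis Har : Cmod a < r.

Let Hr : 0 < r.
Proof. pose proof (Cmod_ge_0 a). lra. Qed.

Let Hnz t : circ r t <> 0%C.
Proof. apply Cmod_gt_0. rewrite Cmod_circ; lra. Qed.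

Let Hna t : circ r t <> a.
Proof. intros E. assert (Cmod (circ r t) = Cmod a) by now f_equal. rewrite Cmod_circ in H; lra. Qed.

(** Since [Ci * circ r t] is the velocity of the circle, the expression is dz / (z - a) written in
    the parameter t. *)
Lemma kernel_bound t : Cmod (/ (circ r t - a) * (Ci * circ r t)) <= r / (r - Cmod a).
Proof.
rewrite !Cmod_mult, Cmod_Ci, Cmod_inv, Cmod_circ by (try apply Cminus_eq_contra; auto; lra).
pose proof (Cmod_triangle_rev (circ r t) a) as H. rewrite Cmod_circ in H by lra.
unfold Rdiv. rewrite Rmult_1_l, Rmult_comm. apply Rmult_le_compat_l; [lra|].
apply Rinv_le_contravar; lra.
Qed.

Lemma kernel_cont t : Pcontinuous (fun t => / (circ r t - a) * (Ci * circ r t))%C t.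
Proof.
apply Pcontinuous_mult.
- apply (Pcontinuous_comp (fun w => / (w - a))%C).
  + now apply ex_Cderive_inv_minus.
  + apply Pcontinuous_circ.
- apply Pcontinuous_mult; [apply Pcontinuous_const|apply Pcontinuous_circ].
Qed.

(** On the shrunken curve a + s e(t) the form dz / (z - a) is the same kernel k(t) dt for every s >
    0. Hence the integral of f(a + s e) k is constant in s; it is the left side at s = 1 and tends
    to the right side as s tends to 0. *)
Lemma cauchy_circle (f : C -> C) : r < 1 -> analytic_D f ->
  PRInt (fun t => f (circ r t) * (/ (circ r t - a) * (Ci * circ r t)))%C 0 (2 * PI) =
  (f a * PRInt (fun t => / (circ r t - a) * (Ci * circ r t)) 0 (2 * PI))%C.
Proof.
intros Hr1 Hf. pose proof PI_RGT_0 as Hpi. pose proof (Cmod_ge_0 a) as Ha0.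
set (e := fun t => (circ r t - a)%C).
set (k := fun t => (/ (circ r t - a) * (Ci * circ r t))%C).
assert (Hin : forall s t, 0 <= s <= 1 -> Cmod (a + RtoC s * e t) < 1).
{ intros s t Hs. unfold e.
  replace (a + RtoC s * (circ r t - a))%C with (RtoC (1 - s) * a + RtoC s * circ r t)%C
    by (rewrite RtoC_minus; ring).
  eapply Rle_lt_trans; [apply Cmod_triangle|].
  rewrite !Cmod_mult, !Cmod_R, !Rabs_pos_eq, Cmod_circ by lra. nra. }
assert (HfG : forall s t, 0 <= s <= 1 -> Pcontinuous (fun t => f (a + RtoC s * e t))%C t).
{ intros s t Hs. apply (Pcontinuous_comp f (fun t => a + RtoC s * e t)%C).
  - apply Hf, Hin, Hs.
  - eapply Pcontinuous_of_Pderive.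
    apply (is_Pderive_comp (fun w => a + RtoC s * (w - a))%C (circ r)); [|apply is_Pderive_circ].
    apply is_Cderive_plus; [apply is_Cderive_const|].
    apply (is_Cderive_mult (fun _ => RtoC s) (fun w => w - a)%C); [apply is_Cderive_const|].
    apply is_Cderive_minus; [apply is_Cderive_id|apply is_Cderive_const]. }
assert (Hshift : forall s, 0 < s <= 1 ->
  PRInt (fun t => f (a + RtoC s * e t) * k t)%C 0 (2 * PI) =
  PRInt (fun t => f (a + RtoC 1 * e t) * k t)%C 0 (2 * PI)).
{ intros s Hs.
  assert (G := goursat_cone (fun w => f w * / (w - a))%C a e (fun t => Ci * circ r t)%C (2 * r) s).
  specialize (G ltac:(lra)).
  assert (He : forall t, is_Pderive e t (Ci * circ r t)).
  { intros t. eapply is_Pderive_eq.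
    - apply (is_Pderive_comp (fun w => w - a)%C (circ r)); [|apply is_Pderive_circ].
      apply is_Cderive_minus; [apply is_Cderive_id|apply is_Cderive_const].
    - ring. }
  specialize (G He).
  assert (Hde : forall t, Pcontinuous (fun t => Ci * circ r t)%C t).
  { intros t. apply Pcontinuous_mult; [apply Pcontinuous_const|apply Pcontinuous_circ]. }
  specialize (G Hde).
  assert (H1 : forall t, Cmod (e t) <= 2 * r).
  { intros t. unfold e, Cminus. eapply Rle_trans; [apply Cmod_triangle|].
    rewrite Cmod_opp, Cmod_circ; lra. }
  specialize (G H1).
  assert (H2 : forall t, Cmod (Ci * circ r t) <= 2 * r).
  { intros t. rewrite Cmod_mult, Cmod_Ci, Cmod_circ; lra. }
  specialize (G H2).
  assert (H3 : forall x t, Cmod (e x - e t) <= 2 * r * Rabs (x - t)).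
  { intros x t. unfold e. replace (circ r x - a - (circ r t - a))%C with (circ r x - circ r t)%C by ring.
    eapply Rle_trans; [apply circ_lipschitz; lra|]. pose proof (Rabs_pos (x - t)). nra. }
  specialize (G H3).
  assert (Hene : forall x t, 0 < x -> (RtoC x * e t)%C <> 0%C).
  { intros x t Hx. apply Cmult_neq_0.
    - intros E. apply RtoC_inj in E. lra.
    - now apply Cminus_eq_contra. }
  assert (H4 : forall x t, s <= x <= 1 ->
    ex_derive (fun w => f w * / (w - a))%C (a + RtoC x * e t)%C).
  { intros x t Hx. apply ex_Cderive_mult.
    - apply Hf, Hin. lra.
    - apply ex_Cderive_inv_minus. intros E. apply (Hene x t ltac:(lra)).
      transitivity ((a + RtoC x * e t) - a)%C; [ring|]. rewrite E. ring. }
  specialize (G H4 0 (2 * PI) ltac:(lra)).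
  (* By periodicity the two straight sides of the cone are the same segment, so their integrals
     cancel. *)
  assert (Ee : e (2 * PI) = e 0).
  { unfold e, circ. now rewrite cos_2PI, sin_2PI, cos_0, sin_0. }
  rewrite Ee in G.
  (* The factor x of the velocity cancels the factor x in z - a = x e(t). *)
  assert (Hk : forall x, 0 < x -> forall t,
    (f (a + RtoC x * e t) * / (a + RtoC x * e t - a) * (RtoC x * (Ci * circ r t)) =
     f (a + RtoC x * e t) * k t)%C).
  { intros x Hx t. unfold k. fold (e t).
    replace (a + RtoC x * e t - a)%C with (RtoC x * e t)%C by ring.
    field. split.
    - now apply Cminus_eq_contra.
    - intros E. apply RtoC_inj in E. lra. }
  rewrite (PRInt_ext _ (fun t => f (a + RtoC s * e t) * k t)%C 0 (2 * PI)) in G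
    by (try lra; intros; apply Hk; lra).
  rewrite (PRInt_ext (fun t => f (a + RtoC 1 * e t) * / (a + RtoC 1 * e t - a) * (RtoC 1 * (Ci * circ r t)))%C
    (fun t => f (a + RtoC 1 * e t) * k t)%C 0 (2 * PI)) in G
    by (try lra; intros; apply Hk; lra).
  match type of G with (?x + ?y - ?z - ?y)%C = _ => 
    apply Ceq_minus; rewrite <- G; ring end. }
rewrite (PRInt_ext _ (fun t => f (a + RtoC 1 * e t) * k t)%C 0 (2 * PI)).
2: lra.
2: { intros t _. unfold e, k. do 2 f_equal. ring. }
apply Ceq_minus, Cmod_eq_0, Rle_antisym; [|apply Cmod_ge_0].
assert (Hk0 : 0 < r / (r - Cmod a)) by (apply Rdiv_lt_0_compat; lra).
apply (Rle_zero_of_small _ (2 * PI * (r / (r - Cmod a)))). intros eps Heps.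
destruct (Ccontinuous_of_ex_derive f a (Hf a ltac:(lra)) eps Heps) as [d [Hd0 Hd]].
(* As |e(t)| <= 2 r, this s brings the whole shrunken curve within distance d of a. *)
set (s := Rmin 1 (d / (4 * r))).
assert (Hs : 0 < s <= 1).
{ split; [apply Rmin_pos; [lra|apply Rdiv_lt_0_compat; lra]|apply Rmin_l]. }
assert (Hsd : s * (2 * r) < d).
{ apply Rle_lt_trans with (d / (4 * r) * (2 * r)).
  - apply Rmult_le_compat_r; [lra|apply Rmin_r].
  - replace (d / (4 * r) * (2 * r)) with (d / 2) by (field; lra). lra. }
rewrite <- (Hshift s Hs).
replace (2 * PI * (r / (r - Cmod a)) * eps) with ((2 * PI - 0) * (eps * (r / (r - Cmod a)))) by ring.
apply Cmod_PRInt_le with (f := fun t => (f (a + RtoC s * e t) * k t - f a * k t)%C); [lra| |].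
- intros t _.
  replace (f (a + RtoC s * e t) * k t - f a * k t)%C with ((f (a + RtoC s * e t) - f a) * k t)%C by ring.
  rewrite Cmod_mult. apply Rmult_le_compat; try apply Cmod_ge_0; [|apply kernel_bound].
  left. apply Hd. replace (a + RtoC s * e t - a)%C with (RtoC s * e t)%C by ring.
  rewrite Cmod_mult, Cmod_R, Rabs_pos_eq by lra.
  eapply Rle_lt_trans; [|exact Hsd]. apply Rmult_le_compat_l; [lra|].
  unfold e, Cminus. eapply Rle_trans; [apply Cmod_triangle|].
  rewrite Cmod_opp, Cmod_circ; lra.
- apply is_PRInt_minus.
  + apply ex_PRInt_continuous; [lra|]. intros t _. apply Pcontinuous_mult; [apply HfG; lra|apply kernel_cont].
  + assert (Hc : PRInt (fun t => f a * k t)%C 0 (2 * PI) = (f a * PRInt k 0 (2 * PI))%C).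
    { apply PRInt_Cmult; [lra|]. intros; apply kernel_cont. }
    assert (H0 : is_PRInt (fun t => f a * k t)%C 0 (2 * PI) (PRInt (fun t => f a * k t)%C 0 (2 * PI))).
    { apply ex_PRInt_continuous; [lra|].
      intros t _. apply Pcontinuous_mult; [apply Pcontinuous_const|apply kernel_cont]. }
    rewrite Hc in H0. exact H0.
Qed.
End Circle.

(** * Complex series and Taylor expansion on smaller discs *)

(** Convergence is phrased through real moduli, so that limits of real sequences apply. The partial
    sum at n runs over the indices below n. *)
Definition csums (u : nat -> C) (l : C) : Prop :=
  is_lim_seq (fun n => Cmod (csum u n - l)) 0.

Definition csums_powers (c : nat -> C) (z l : C) : Prop :=
  csums (fun n => c n * z ^ n)%C l.

Lemma is_lim_seq_0_le (u v : nat -> R) :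
  (forall n, 0 <= u n <= v n) -> is_lim_seq v 0 -> is_lim_seq u 0.
Proof.
intros H Hv. apply (is_lim_seq_le_le (fun _ => 0) u v); auto. apply is_lim_seq_const.
Qed.

Lemma is_lim_seq_0_eventually_le (u : nat -> R) : (forall n, 0 <= u n) ->
  (forall eps, 0 < eps -> exists N, forall n, (N <= n)%nat -> u n <= eps) -> is_lim_seq u 0.
Proof.
intros H0 H. apply is_lim_seq_spec. intros eps.
destruct (H (eps / 2) (is_pos_div_2 eps)) as [N HN]. exists N. intros n Hn.
rewrite Rminus_0_r, Rabs_pos_eq by auto. specialize (HN n Hn).
pose proof (cond_pos eps). lra.
Qed.

Lemma is_lim_seq_0_le_eventually (u : nat -> R) : is_lim_seq u 0 ->
  forall eps, 0 < eps -> exists N, forall n, (N <= n)%nat -> u n <= eps.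
Proof.
intros H eps Heps. apply is_lim_seq_spec in H. destruct (H (mkposreal eps Heps)) as [N HN].
exists N. intros n Hn. specialize (HN n Hn). simpl in HN. rewrite Rminus_0_r in HN.
pose proof (Rle_abs (u n)). lra.
Qed.

Lemma is_lim_seq_geom_scal (K q : R) : 0 <= q < 1 -> is_lim_seq (fun n => K * q ^ n) 0.
Proof.
intros Hq. replace (Finite 0) with (Rbar_mult K 0) by (simpl; f_equal; ring).
apply is_lim_seq_scal_l, is_lim_seq_geom. rewrite Rabs_pos_eq; lra.
Qed.

Lemma csum_ext (u v : nat -> C) (n : nat) :
  (forall k, (k < n)%nat -> u k = v k) -> csum u n = csum v n.
Proof.
induction n as [|n IH]; intros H; simpl; auto. rewrite IH, H; auto.
Qed.

Lemma csum_plus (u v : nat -> C) (n : nat) :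
  csum (fun k => u k + v k)%C n = (csum u n + csum v n)%C.
Proof. induction n as [|n IH]; simpl; [ring|]. rewrite IH. ring. Qed.

Lemma csum_scal (c : C) (u : nat -> C) (n : nat) :
  csum (fun k => c * u k)%C n = (c * csum u n)%C.
Proof. induction n as [|n IH]; simpl; [ring|]. rewrite IH. ring. Qed.

Lemma csum_shift (u : nat -> C) (n : nat) :
  csum u (S n) = (u 0%nat + csum (fun k => u (S k)) n)%C.
Proof. induction n as [|n IH]; [simpl; ring|]. change (csum u (S (S n))) with (csum u (S n) + u (S n))%C. rewrite IH. simpl. ring. Qed.

Lemma csum_zero (n : nat) : csum (fun _ => 0%C) n = 0%C.
Proof. induction n as [|n IH]; simpl; [ring|]. rewrite IH. ring. Qed.

Lemma csums_zero : csums (fun _ => 0%C) 0%C.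
Proof.
apply (is_lim_seq_ext (fun _ => 0)); [|apply is_lim_seq_const].
intros n. rewrite csum_zero. replace (0 - 0)%C with (RtoC 0) by ring. now rewrite Cmod_0.
Qed.

Lemma csums_unique (u : nat -> C) (l m : C) : csums u l -> csums u m -> l = m.
Proof.
intros Hl Hm. apply Ceq_minus, Cmod_eq_0, Rle_antisym; [|apply Cmod_ge_0].
assert (H : is_lim_seq (fun n => Cmod (csum u n - l) + Cmod (csum u n - m)) 0).
{ replace (Finite 0) with (Rbar_plus 0 0) by (simpl; f_equal; ring).
  apply is_lim_seq_plus'; assumption. }
assert (E : Rbar_le (Cmod (l - m)) 0); [|exact E].
refine (is_lim_seq_le (fun _ => Cmod (l - m)) _ _ _ _ (is_lim_seq_const _) H).
intros n. rewrite (Cmod_minus_sym _ l).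
replace (l - m)%C with ((l - csum u n) + (csum u n - m))%C by ring. apply Cmod_triangle.
Qed.

Lemma csums_plus (u v : nat -> C) (l m : C) :
  csums u l -> csums v m -> csums (fun n => u n + v n)%C (l + m)%C.
Proof.
intros Hl Hm.
apply is_lim_seq_0_le with (v := fun n => Cmod (csum u n - l) + Cmod (csum v n - m)).
- intros n. split; [apply Cmod_ge_0|]. rewrite csum_plus.
  replace (csum u n + csum v n - (l + m))%C with ((csum u n - l) + (csum v n - m))%C by ring.
  apply Cmod_triangle.
- replace (Finite 0) with (Rbar_plus 0 0) by (simpl; f_equal; ring).
  apply is_lim_seq_plus'; assumption.
Qed.

Lemma csums_scal (c : C) (u : nat -> C) (l : C) :
  csums u l -> csums (fun n => c * u n)%C (c * l)%C.
Proof.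
intros Hl. apply is_lim_seq_0_le with (v := fun n => Cmod c * Cmod (csum u n - l)).
- intros n. split; [apply Cmod_ge_0|]. rewrite csum_scal, <- Cmod_mult. right. f_equal. ring.
- replace (Finite 0) with (Rbar_mult (Cmod c) 0) by (simpl; f_equal; ring).
  now apply is_lim_seq_scal_l.
Qed.

Lemma csums_ext (u v : nat -> C) (l : C) :
  (forall n, u n = v n) -> csums u l -> csums v l.
Proof.
intros H. apply is_lim_seq_ext. intros n. do 2 f_equal. apply csum_ext; auto.
Qed.

Lemma csums_minus (u v : nat -> C) (l m : C) :
  csums u l -> csums v m -> csums (fun n => u n - v n)%C (l - m)%C.
Proof.
intros Hl Hm. replace (l - m)%C with (l + - (1) * m)%C by ring.
apply (csums_ext (fun n => u n + - (1) * v n)%C); [intros; ring|].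
apply csums_plus; auto. now apply csums_scal.
Qed.

Lemma csums_shift (u : nat -> C) (l : C) :
  csums u l <-> csums (fun n => u (S n)) (l - u 0%nat)%C.
Proof.
unfold csums. rewrite (is_lim_seq_incr_1 (fun n => Cmod (csum u n - l))).
split; apply is_lim_seq_ext; intros n; f_equal; rewrite csum_shift; ring.
Qed.

Lemma csums_Cmod_le (u : nat -> C) (l : C) (B : R) :
  csums u l -> (forall n, Cmod (csum u n) <= B) -> Cmod l <= B.
Proof.
intros Hl HB.
assert (E : Rbar_le (Cmod l) (B + 0)); [|simpl in E; lra].
apply (is_lim_seq_le (fun _ => Cmod l) (fun n => B + Cmod (csum u n - l))).
- intros n. replace l with (csum u n + - (csum u n - l))%C at 1 by ring.
  eapply Rle_trans; [apply Cmod_triangle|]. rewrite Cmod_opp. specialize (HB n). lra.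
- apply is_lim_seq_const.
- apply is_lim_seq_plus'; [apply is_lim_seq_const|exact Hl].
Qed.

Lemma csum_geom_le (u : nat -> C) (K q : R) (n : nat) : 0 <= q < 1 ->
  (forall k, Cmod (u k) <= K * q ^ k) -> Cmod (csum u n) <= K / (1 - q).
Proof.
intros Hq Hu.
assert (HK : 0 <= K).
{ specialize (Hu O). simpl in Hu. pose proof (Cmod_ge_0 (u O)). lra. }
(* The exact finite geometric sum is the form of the bound that passes through the induction. *)
assert (H : Cmod (csum u n) <= K / (1 - q) * (1 - q ^ n)).
{ induction n as [|n IH]; simpl.
  - rewrite Cmod_0. lra.
  - eapply Rle_trans; [apply Cmod_triangle|].
    replace (K / (1 - q) * (1 - q * q ^ n)) with (K / (1 - q) * (1 - q ^ n) + K * q ^ n)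
      by (field; lra).
    specialize (Hu n). lra. }
eapply Rle_trans; [exact H|].
assert (0 <= q ^ n) by (apply pow_le; lra).
assert (0 <= K / (1 - q)) by (apply Rmult_le_pos; [lra|left; apply Rinv_0_lt_compat; lra]).
nra.
Qed.

Lemma ex_csums_geom (u : nat -> C) (K q : R) : 0 <= q < 1 ->
  (forall k, Cmod (u k) <= K * q ^ k) -> exists l, csums u l.
Proof.
intros Hq Hu.
assert (Hex : forall (p : C -> R), (forall z, Rabs (p z) <= Cmod z) -> ex_series (fun n => p (u n))).
{ intros p Hp. apply (ex_series_le (K:=R_AbsRing) (V:=R_CompleteNormedModule) _ (fun n => K * q ^ n)).
  - intros n. eapply Rle_trans; [apply Hp|apply Hu].
  - assert (Hg : ex_series (fun n => q ^ n)) by (apply ex_series_geom; rewrite Rabs_pos_eq; lra).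
    exact (ex_series_scal_l K _ Hg). }
assert (Him : forall z, Rabs (Im z) <= Cmod z).
{ intros z. eapply Rle_trans; [|apply Rmax_Cmod]. apply Rmax_r. }
destruct (Hex Re re_le_Cmod) as [x Hx]. destruct (Hex Im Him) as [y Hy].
exists (x, y).
(* [sum_n] includes its last index while [csum] does not, hence the shift by one. *)
assert (EP : forall n, csum u (S n) =
  (sum_n (fun k => Re (u k)) n, sum_n (fun k => Im (u k)) n)).
{ induction n as [|n IH].
  - rewrite !sum_O. simpl. destruct (u 0%nat). unfold Cplus; simpl. f_equal; ring.
  - change (csum u (S (S n))) with (csum u (S n) + u (S n))%C. rewrite IH, !sum_Sn. reflexivity. }
apply is_lim_seq_incr_1.
apply is_lim_seq_0_le with (v := fun n =>
  Rabs (sum_n (fun k => Re (u k)) n - x) + Rabs (sum_n (fun k => Im (u k)) n - y)).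
- intros n. split; [apply Cmod_ge_0|]. rewrite EP. eapply Rle_trans; [apply Cmod_le_abs|]. simpl. right. reflexivity.
- replace (Finite 0) with (Rbar_plus (Rabs (x - x)) (Rabs (y - y)))
    by (simpl; f_equal; rewrite !Rminus_diag, Rabs_R0; ring).
  apply is_lim_seq_plus'; apply (is_lim_seq_abs _ (Finite _)); apply is_lim_seq_minus';
    try apply is_lim_seq_const; assumption.
Qed.

Lemma is_Cderive_pow (n : nat) (z : C) :
  is_Cderive (fun w => w ^ S n)%C z (RtoC (INR (S n)) * z ^ n).
Proof.
induction n as [|n IH].
- eapply is_Cderive_eq.
  + apply (is_Cderive_mult (fun w => w) (fun _ => 1%C)); [apply is_Cderive_id|apply is_Cderive_const].
  + simpl. ring.
- eapply is_Cderive_eq.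
  + apply (is_Cderive_mult (fun w => w) (fun w => w ^ S n)%C); [apply is_Cderive_id|exact IH].
  + rewrite (S_INR (S n)), RtoC_plus. rewrite !Cpow_S. ring.
Qed.

Lemma PRInt_minus (f g : R -> C) (a b : R) : a <= b ->
  (forall t, a <= t <= b -> Pcontinuous f t) -> (forall t, a <= t <= b -> Pcontinuous g t) ->
  PRInt (fun t => f t - g t)%C a b = (PRInt f a b - PRInt g a b)%C.
Proof.
intros Hab Hf Hg. apply (is_RInt_unique (V:=C_R_CompleteNormedModule)).
apply is_PRInt_minus; now apply ex_PRInt_continuous.
Qed.

(** * Cauchy integrals as power series *)

Section Expansion.
Variable r : R.
Hypothesis Hr : 0 < r.

Let Hnz t : circ r t <> 0%C.
Proof. apply Cmod_gt_0. rewrite Cmod_circ; lra. Qed.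

(** This is the integral of f(z) z^(-n-1) dz over the circle, because dz = i z dt: 2 pi i times the
    n-th Taylor coefficient. *)
Definition moment (f : C -> C) (n : nat) : C :=
  PRInt (fun t => f (circ r t) * (Ci * (/ circ r t) ^ n))%C 0 (2 * PI).

Let is_Pderive_inv_pow n t :
  is_Pderive (fun t => (/ circ r t) ^ S n)%C t (- (RtoC (INR (S n)) * (Ci * (/ circ r t) ^ S n))).
Proof.
eapply is_Pderive_eq.
- apply (is_Pderive_comp (fun w => w ^ S n)%C (fun t => / circ r t)%C); [apply is_Cderive_pow|].
  apply (is_Pderive_comp (fun w => / w)%C (circ r)); [now apply is_Cderive_inv|apply is_Pderive_circ].
- rewrite Cpow_S. field. apply Hnz.
Qed.

Let inv_pow_cont n t : Pcontinuous (fun t => (/ circ r t) ^ n)%C t.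
Proof.
destruct n as [|n]; [apply Pcontinuous_const|].
eapply Pcontinuous_of_Pderive, is_Pderive_inv_pow.
Qed.

(** The integrand has the periodic primitive - z^(-n-1) / (n + 1). *)
Lemma moment_one_S (n : nat) : moment (fun _ => 1%C) (S n) = 0%C.
Proof.
pose proof PI_RGT_0 as Hpi.
assert (Hn : RtoC (INR (S n)) <> 0%C).
{ intros E. apply RtoC_inj in E. revert E. apply not_0_INR. lia. }
unfold moment. apply (is_RInt_unique (V:=C_R_CompleteNormedModule)).
set (F := fun t => (- / RtoC (INR (S n)) * (/ circ r t) ^ S n)%C).
replace (RtoC 0) with (F (2 * PI)%R - F 0%R)%C.
- apply is_PRInt_derive; [lra| |].
  + intros t _. eapply is_Pderive_eq.
    * apply (is_Pderive_comp (fun w => - / RtoC (INR (S n)) * w)%C (fun t => (/ circ r t) ^ S n)%C);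
        [|apply is_Pderive_inv_pow].
      apply (is_Cderive_mult (fun _ => - / RtoC (INR (S n)))%C (fun w => w));
        [apply is_Cderive_const|apply is_Cderive_id].
    * cbv beta. field. exact Hn.
  + intros t _. apply Pcontinuous_mult; [apply Pcontinuous_const|].
    apply Pcontinuous_mult; [apply Pcontinuous_const|apply inv_pow_cont].
- unfold F, circ. rewrite cos_2PI, sin_2PI, cos_0, sin_0. ring.
Qed.

Lemma moment_one_0 : moment (fun _ => 1%C) 0 = (RtoC (2 * PI) * Ci)%C.
Proof.
pose proof PI_RGT_0 as Hpi.
unfold moment. apply (is_RInt_unique (V:=C_R_CompleteNormedModule)).
set (F := fun t => (Ci * RtoC t)%C).
replace (RtoC (2 * PI) * Ci)%C with (F (2 * PI)%R - F 0%R)%C by (unfold F; ring).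
apply is_PRInt_derive; [lra| |].
- intros t _. eapply is_Pderive_eq.
  + apply (is_Pderive_comp (fun w => Ci * w)%C RtoC); [|apply is_Pderive_RtoC].
    apply (is_Cderive_mult (fun _ => Ci) (fun w => w)); [apply is_Cderive_const|apply is_Cderive_id].
  + simpl. ring.
- intros t _. apply Pcontinuous_const.
Qed.

Lemma Cmod_moment_le (f : C -> C) (n : nat) (F : R) :
  (forall t, Pcontinuous (fun t => f (circ r t)) t) ->
  (forall t, 0 <= t <= 2 * PI -> Cmod (f (circ r t)) <= F) -> Cmod (moment f n) * r ^ n <= 2 * PI * F.
Proof.
intros Hc HF. pose proof PI_RGT_0 as Hpi.
assert (Hrn : 0 < r ^ n) by now apply pow_lt.
assert (H : Cmod (moment f n) <= (2 * PI - 0) * (F * / r ^ n)).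
{ apply Cmod_PRInt_le with (f := fun t => (f (circ r t) * (Ci * (/ circ r t) ^ n))%C); [lra| |].
  - intros t Ht. rewrite !Cmod_mult, Cmod_Ci, Cmod_pow, Cmod_inv, Cmod_circ by (auto; lra).
    rewrite Rmult_1_l, pow_inv. apply Rmult_le_compat_r; [left; now apply Rinv_0_lt_compat|].
    now apply HF.
  - apply ex_PRInt_continuous; [lra|]. intros t _. apply Pcontinuous_mult; auto.
    apply Pcontinuous_mult; [apply Pcontinuous_const|apply inv_pow_cont]. }
apply (Rmult_le_compat_r (r ^ n)) in H; [|lra].
replace ((2 * PI - 0) * (F * / r ^ n) * r ^ n) with (2 * PI * F) in H by (field; lra). exact H.
Qed.

(** The geometric expansion of 1 / (z - a) in powers of a / z is used with its exact remainder, so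
    no sum is interchanged with an integral. *)
Lemma kernel_expansion (a : C) (f : C -> C) (F : R) : Cmod a < r ->
  (forall t, Pcontinuous (fun t => f (circ r t)) t) ->
  (forall t, 0 <= t <= 2 * PI -> Cmod (f (circ r t)) <= F) ->
  csums_powers (moment f) a
    (PRInt (fun t => f (circ r t) * (/ (circ r t - a) * (Ci * circ r t)))%C 0 (2 * PI)).
Proof.
intros Har Hc HF. pose proof PI_RGT_0 as Hpi.
set (k := fun t => (/ (circ r t - a) * (Ci * circ r t))%C).
assert (Hna : forall t, circ r t <> a).
{ intros t E. assert (Cmod (circ r t) = Cmod a) by now f_equal. rewrite Cmod_circ in H; lra. }
assert (Hk : forall t, Pcontinuous k t).
{ intros t. now apply kernel_cont. }
(* [T n] is the remainder after n terms: the kernel multiplied by (a / z)^n, of size O((|a| /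
   r)^n). *)
set (T := fun n => PRInt (fun t => f (circ r t) * (a ^ n * ((/ circ r t) ^ n * k t)))%C 0 (2 * PI)).
assert (Hcn : forall n t, Pcontinuous (fun t => f (circ r t) * (a ^ n * ((/ circ r t) ^ n * k t)))%C t).
{ intros n t. apply Pcontinuous_mult; auto. apply Pcontinuous_mult; [apply Pcontinuous_const|].
  apply Pcontinuous_mult; auto. }
assert (Hcm : forall n t, Pcontinuous (fun t => f (circ r t) * (Ci * (/ circ r t) ^ n))%C t).
{ intros n t. apply Pcontinuous_mult; auto. apply Pcontinuous_mult; [apply Pcontinuous_const|apply inv_pow_cont]. }
assert (HT : forall n, T n = (moment f n * a ^ n + T (S n))%C).
{ intros n. assert (E : (T n - T (S n) = a ^ n * moment f n)%C).
  { unfold T, moment. rewrite <- PRInt_minus, <- PRInt_Cmult by (auto; lra).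
    apply PRInt_ext; [lra|]. intros t _. unfold k. rewrite !Cpow_S. field. split; [now apply Cminus_eq_contra|apply Hnz]. }
  replace (T n) with ((T n - T (S n)) + T (S n))%C by ring. rewrite E. ring. }
assert (HT0 : forall n, T 0%nat = (csum (fun n => moment f n * a ^ n) n + T n)%C).
{ induction n as [|n IH]; simpl; [ring|]. rewrite IH, (HT n). ring. }
assert (HF0 : 0 <= F).
{ eapply Rle_trans; [apply Cmod_ge_0|apply (HF 0)]; lra. }
assert (Hb : forall n, Cmod (T n) <= 2 * PI * F * (r / (r - Cmod a)) * (Cmod a / r) ^ n).
{ intros n. replace (2 * PI * F * (r / (r - Cmod a)) * (Cmod a / r) ^ n)
    with ((2 * PI - 0) * (F * ((Cmod a / r) ^ n * (r / (r - Cmod a))))) by ring.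
  apply Cmod_PRInt_le with (f := fun t => (f (circ r t) * (a ^ n * ((/ circ r t) ^ n * k t)))%C); [lra| |].
  - intros t Ht. rewrite Cmod_mult. apply Rmult_le_compat; try apply Cmod_ge_0.
    + now apply HF.
    + rewrite Cmult_assoc, <- Cpow_mult_l, Cmod_mult, Cmod_pow, Cmod_mult, Cmod_inv, Cmod_circ by (auto; lra).
      apply Rmult_le_compat_l.
      * apply pow_le. apply Rmult_le_pos; [apply Cmod_ge_0|left; now apply Rinv_0_lt_compat].
      * now apply kernel_bound.
  - apply ex_PRInt_continuous; [lra|]. auto. }
assert (HTe : T 0%nat = PRInt (fun t => f (circ r t) * k t)%C 0 (2 * PI)).
{ apply PRInt_ext; [lra|]. intros t _. simpl. ring. }
unfold k in HTe. rewrite <- HTe.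
apply is_lim_seq_0_le with (v := fun n => 2 * PI * F * (r / (r - Cmod a)) * (Cmod a / r) ^ n).
- intros n. split; [apply Cmod_ge_0|]. rewrite (HT0 n).
  replace (csum (fun n => moment f n * a ^ n) n - (csum (fun n => moment f n * a ^ n) n + T n))%C
    with (- T n)%C by ring. rewrite Cmod_opp. apply Hb.
- apply is_lim_seq_geom_scal. pose proof (Cmod_ge_0 a). split.
  + apply Rmult_le_pos; [lra|left; now apply Rinv_0_lt_compat].
  + apply Rlt_div_l; lra.
Qed.

(** For f = 1 only the moment of index 0 survives in the expansion, so the total is independent of
    a. *)
Lemma kernel_total (a : C) : Cmod a < r ->
  PRInt (fun t => / (circ r t - a) * (Ci * circ r t))%C 0 (2 * PI) = (RtoC (2 * PI) * Ci)%C.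
Proof.
intros Har. pose proof PI_RGT_0 as Hpi.
assert (H := kernel_expansion a (fun _ => 1%C) 1 Har (fun t => Pcontinuous_const _ t)
  (fun t _ => Req_le _ _ Cmod_1)).
rewrite (PRInt_ext _ (fun t => 1 * (/ (circ r t - a) * (Ci * circ r t)))%C) by (try lra; intros; ring).
apply (csums_unique _ _ _ H). apply csums_shift.
apply (csums_ext (fun _ => 0%C)).
{ intros n. rewrite moment_one_S. ring. }
rewrite moment_one_0.
replace (_ - _)%C with (RtoC 0) by (simpl; ring). apply csums_zero.
Qed.

(** The first bound comes from compactness of the circle and gives convergence for each single f.
    The second is Cauchy's estimate with an explicit constant, which later makes the bounds uniform
    over a family. *)
Lemma local_power_series (f : C -> C) : r < 1 -> analytic_D f ->
  exists c : nat -> C,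
    (exists K, forall n, Cmod (c n) * r ^ n <= K) /\
    (forall F, (forall z, Cmod z = r -> Cmod (f z) <= F) -> forall n, Cmod (c n) * r ^ n <= F) /\
    forall z, Cmod z < r -> csums_powers c z (f z).
Proof.
intros Hr1 Hf. pose proof PI_RGT_0 as Hpi.
assert (Hc : forall t, Pcontinuous (fun t => f (circ r t)) t).
{ intros t. apply Pcontinuous_comp; [apply Hf; rewrite Cmod_circ; lra|apply Pcontinuous_circ]. }
assert (HF : exists F, forall t, 0 <= t <= 2 * PI -> Cmod (f (circ r t)) <= F).
{ destruct (continuity_ab_maj (fun t => Cmod (f (circ r t))) 0 (2 * PI)) as [M [HM _]]; [lra| |].
  - intros t _ eps Heps. destruct (proj1 (Pcontinuous_eps _ _) (Hc t) eps Heps) as [d [Hd0 Hd]].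
    exists d. split; auto. intros s [_ Hs].
    eapply Rle_lt_trans; [|apply (Hd s Hs)]. apply Rabs_le. split.
    + pose proof (Cmod_triangle_rev (f (circ r t)) (f (circ r s))) as T. rewrite Cmod_minus_sym in T. lra.
    + apply Cmod_triangle_rev.
  - now exists (Cmod (f (circ r M))). }
set (J := (RtoC (2 * PI) * Ci)%C).
assert (HJ : J <> 0%C).
{ apply Cmult_neq_0; [|apply Ci_nz]. intros E. apply RtoC_inj in E. lra. }
assert (HJm : Cmod J = 2 * PI).
{ unfold J. rewrite Cmod_mult, Cmod_Ci, Cmod_R, Rabs_pos_eq; lra. }
exists (fun n => / J * moment f n)%C. split; [|split].
- destruct HF as [F HF]. exists (/ (2 * PI) * (2 * PI * F)). intros n.
  rewrite Cmod_mult, Cmod_inv, HJm, Rmult_assoc by auto.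
  apply Rmult_le_compat_l; [left; apply Rinv_0_lt_compat; lra|].
  exact (Cmod_moment_le f n F Hc HF).
- intros F HFb n. rewrite Cmod_mult, Cmod_inv, HJm by auto.
  apply (Rmult_le_reg_l (2 * PI)); [lra|].
  pose proof (Cmod_moment_le f n F Hc (fun t _ => HFb _ (Cmod_circ r t (Rlt_le _ _ Hr)))).
  replace (2 * PI * (/ (2 * PI) * Cmod (moment f n) * r ^ n)) with (Cmod (moment f n) * r ^ n)
    by (field; lra). exact H.
- intros z Hz. destruct HF as [F HF].
  pose proof (kernel_expansion z f F Hz Hc HF) as H.
  rewrite (cauchy_circle z r Hz f Hr1 Hf), (kernel_total z Hz) in H. fold J in H.
  apply (csums_scal (/ J)) in H.
  replace (/ J * (f z * J))%C with (f z) in H by (field; auto).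
  revert H. apply csums_ext. intros n. ring.
Qed.
End Expansion.

(** * Power series on the unit disc *)

Lemma csums_powers_0 (c : nat -> C) : csums_powers c 0%C (c 0%nat).
Proof.
apply csums_shift. simpl. replace (c 0%nat - c 0%nat * 1)%C with (RtoC 0) by ring.
apply (csums_ext (fun _ => 0%C)); [intros; simpl; ring|apply csums_zero].
Qed.

(** The factor w will be a power z^n, its derivative in z, or its second-order Taylor remainder; one
    estimate serves function values, derivatives and differentiability. *)
Lemma coef_geom_le (c w : C) (K W r q : R) (n : nat) : 0 < r -> 
  Cmod c * r ^ n <= K -> Cmod w <= W * q ^ n -> Cmod (c * w) <= K * W * (q / r) ^ n.
Proof.
intros Hr Hc Hw. rewrite Cmod_mult.
assert (Hrn : 0 < r ^ n) by now apply pow_lt.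
unfold Rdiv. rewrite Rpow_mult_distr, pow_inv.
replace (Cmod c * Cmod w) with ((Cmod c * r ^ n) * Cmod w * / r ^ n) by (field; lra).
replace (K * W * (q ^ n * / r ^ n)) with (K * (W * q ^ n) * / r ^ n) by ring.
apply Rmult_le_compat_r; [left; now apply Rinv_0_lt_compat|].
apply Rmult_le_compat; auto using Cmod_ge_0.
apply Rmult_le_pos; [apply Cmod_ge_0|lra].
Qed.

Lemma csums_coef_le (c w : nat -> C) (K W r q : R) (l : C) : 0 <= q < r ->
  (forall n, Cmod (c n) * r ^ n <= K) -> (forall n, Cmod (w n) <= W * q ^ n) ->
  csums (fun n => c n * w n)%C l -> Cmod l <= K * W / (1 - q / r).
Proof.
intros Hq Hc Hw Hl. apply (csums_Cmod_le _ _ _ Hl). intros n.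
apply csum_geom_le.
- split; [apply Rmult_le_pos; [lra|left; apply Rinv_0_lt_compat; lra]|apply Rlt_div_l; lra].
- intros k. apply coef_geom_le; auto; lra.
Qed.

Lemma ex_csums_coef (c w : nat -> C) (K W r q : R) : 0 <= q < r ->
  (forall n, Cmod (c n) * r ^ n <= K) -> (forall n, Cmod (w n) <= W * q ^ n) ->
  exists l, csums (fun n => c n * w n)%C l.
Proof.
intros Hq Hc Hw. apply (ex_csums_geom _ (K * W) (q / r)).
- split; [apply Rmult_le_pos; [lra|left; apply Rinv_0_lt_compat; lra]|apply Rlt_div_l; lra].
- intros k. apply coef_geom_le; auto; lra.
Qed.

Lemma csums_powers_shift (c : nat -> C) (z l m : C) :
  csums_powers c z l -> csums_powers (fun n => c (S n)) z m -> l = (c 0%nat + z * m)%C.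
Proof.
intros Hl Hm. apply (csums_unique _ _ _ Hl). apply csums_shift.
replace (c 0%nat + z * m - c 0%nat * z ^ 0)%C with (z * m)%C by (simpl; ring).
apply (csums_ext (fun n => z * (c (S n) * z ^ n))%C); [intros; simpl; ring|].
now apply csums_scal.
Qed.

Lemma coef_shift_le (c : nat -> C) (K r : R) : 0 < r ->
  (forall n, Cmod (c n) * r ^ n <= K) -> forall n, Cmod (c (S n)) * r ^ n <= K / r.
Proof.
intros Hr H n. specialize (H (S n)). simpl in H. apply (proj1 (Rle_div_r _ _ _ Hr)). lra.
Qed.

Lemma Cmod_pow_le (z : C) (q : R) (n : nat) : Cmod z <= q -> Cmod (z ^ n) <= 1 * q ^ n.
Proof. intros H. rewrite Cmod_pow, Rmult_1_l. apply pow_incr. split; [apply Cmod_ge_0|exact H]. Qed.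

(** Once c_0 = 0, division by z gives a series that vanishes off 0, and continuity at 0 lets the
    induction apply to the shifted coefficients. *)
Lemma zero_power_series (n : nat) : forall (c : nat -> C) (K r : R), 0 < r ->
  (forall n, Cmod (c n) * r ^ n <= K) ->
  (forall z, Cmod z < r -> csums_powers c z 0%C) -> c n = 0%C.
Proof.
induction n as [|n IH]; intros c K r Hr HK H.
{ apply (csums_unique _ _ _ (csums_powers_0 c)). apply H. rewrite Cmod_0; lra. }
assert (H0 : c 0%nat = 0%C).
{ apply (csums_unique _ _ _ (csums_powers_0 c)). apply H. rewrite Cmod_0; lra. }
pose proof (coef_shift_le c K r Hr HK) as HK1.
pose proof (coef_shift_le _ _ r Hr HK1) as HK2.
assert (Hne : forall z, Cmod z < r -> z <> 0%C -> csums_powers (fun n => c (S n)) z 0%C).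
{ intros z Hz Hz0. specialize (H z Hz). apply csums_shift in H. rewrite H0 in H.
  apply (csums_scal (/ z)) in H.
  replace (/ z * (0 - 0 * z ^ 0))%C with (RtoC 0) in H by ring.
  revert H. apply csums_ext. intros k. simpl. field. exact Hz0. }
apply (IH (fun n => c (S n)) (K / r) r); auto.
intros z Hz. destruct (Ceq_dec z 0%C) as [->|Hz0]; [|now apply Hne].
replace (RtoC 0) with (c 1%nat) at 2; [apply csums_powers_0|].
apply Cmod_eq_0, Rle_antisym; [|apply Cmod_ge_0].
(* At small real x > 0 one has c_1 = - x m, where m is the value of the twice shifted series; the
   constant bounds |m| for all x <= r / 2. *)
apply (Rle_zero_of_small _ (K / r / r * 1 / (1 - (r / 2) / r))). intros eps Heps.
set (x := Rmin eps (r / 2)).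
assert (Hx : 0 < x /\ x <= eps /\ x <= r / 2).
{ unfold x. split; [apply Rmin_pos; lra|]. split; [apply Rmin_l|apply Rmin_r]. }
clearbody x.
assert (Hmx : Cmod (RtoC x) = x) by (rewrite Cmod_R; apply Rabs_pos_eq; lra).
assert (Hx0 : RtoC x <> 0%C) by (intros E; apply RtoC_inj in E; lra).
specialize (Hne (RtoC x) ltac:(rewrite Hmx; lra) Hx0).
destruct (ex_csums_coef (fun n => c (S (S n))) (fun n => RtoC x ^ n)%C (K / r / r) 1 r (r / 2)) as [m Hm];
  auto; try lra.
{ intros k. apply Cmod_pow_le. lra. }
pose proof (csums_powers_shift _ _ _ _ Hne Hm) as E.
assert (Hb : Cmod m <= K / r / r * 1 / (1 - (r / 2) / r)).
{ apply (csums_coef_le (fun n => c (S (S n))) (fun n => RtoC x ^ n)%C) with (4 := Hm); auto; try lra.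
  intros k. apply Cmod_pow_le. lra. }
replace (c 1%nat) with (- (RtoC x * m))%C.
- rewrite Cmod_opp, Cmod_mult, Hmx. pose proof (Cmod_ge_0 m). rewrite (Rmult_comm _ eps).
  apply Rmult_le_compat; lra.
- replace (c 1%nat) with (c 1%nat + RtoC x * m - RtoC x * m)%C by ring. rewrite <- E. ring.
Qed.

(** Equivalent to a radius of convergence of at least 1. *)
Definition subgeometric (c : nat -> C) : Prop :=
  forall r, 0 < r < 1 -> exists K, forall n, Cmod (c n) * r ^ n <= K.

Lemma coef_le_smaller (c : nat -> C) (K r s : R) : 0 < s <= r ->
  (forall n, Cmod (c n) * r ^ n <= K) -> forall n, Cmod (c n) * s ^ n <= K.
Proof.
intros Hs H n. eapply Rle_trans; [|apply H]. apply Rmult_le_compat_l; [apply Cmod_ge_0|].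
apply pow_incr. lra.
Qed.

(** The coefficients obtained on the circle of radius r are compared with those of radius 1/2: both
    series represent f on the smaller disc, so [zero_power_series] applies to their difference. *)
Lemma disc_power_series (f : C -> C) : analytic_D f ->
  exists c : nat -> C, subgeometric c /\
    (forall r F, 0 < r < 1 -> (forall z, Cmod z = r -> Cmod (f z) <= F) ->
       forall n, Cmod (c n) * r ^ n <= F) /\
    forall z, Cmod z < 1 -> csums_powers c z (f z).
Proof.
intros Hf.
destruct (local_power_series (/ 2) ltac:(lra) f ltac:(lra) Hf) as [c [[K HK] [_ Hc]]].
assert (Hr : forall r, 0 < r < 1 -> (exists K, forall n, Cmod (c n) * r ^ n <= K) /\
    (forall F, (forall z, Cmod z = r -> Cmod (f z) <= F) -> forall n, Cmod (c n) * r ^ n <= F) /\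
    forall z, Cmod z < r -> csums_powers c z (f z)).
{ intros r Hr.
  destruct (local_power_series r ltac:(lra) f ltac:(lra) Hf) as [d [[K' HK'] [HF Hd]]].
  assert (E : forall n, (d n - c n)%C = 0%C).
  { set (s := Rmin r (/ 2)).
    assert (Hs : 0 < s /\ s <= r /\ s <= / 2).
    { unfold s. split; [apply Rmin_pos; lra|]. split; [apply Rmin_l|apply Rmin_r]. }
    clearbody s. intros n.
    apply (zero_power_series n (fun n => d n - c n)%C (K' + K) s); try lra.
    - intros k.
      pose proof (coef_le_smaller c K (/ 2) s ltac:(lra) HK k).
      pose proof (coef_le_smaller d K' r s ltac:(lra) HK' k).
      assert (0 <= s ^ k) by (apply pow_le; lra).
      pose proof (Cmod_triangle (d k) (- c k)) as T. rewrite Cmod_opp in T.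
      apply Rle_trans with ((Cmod (d k) + Cmod (c k)) * s ^ k); [|lra].
      apply Rmult_le_compat_r; auto.
    - intros z Hz. replace (RtoC 0) with (f z - f z)%C by ring.
      apply (csums_ext (fun n => d n * z ^ n - c n * z ^ n)%C); [intros; ring|].
      apply csums_minus; [apply Hd|apply Hc]; lra. }
  assert (E' : forall n, d n = c n) by (intros; apply Ceq_minus, E).
  split; [|split].
  - exists K'. intros n. rewrite <- E'. apply HK'.
  - intros F HFz n. rewrite <- E'. now apply HF.
  - intros z Hz. apply (csums_ext (fun n => d n * z ^ n)%C); [intros; now rewrite E'|now apply Hd]. }
exists c. split; [|split].
- intros r H. apply (Hr r H).
- intros r F H. apply (Hr r H).
- intros z Hz. pose proof (Cmod_ge_0 z). apply (Hr ((1 + Cmod z) / 2)); lra.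
Qed.

Lemma subgeometric_sum (c : nat -> C) : subgeometric c ->
  exists f : C -> C, forall z, Cmod z < 1 -> csums_powers c z (f z).
Proof.
intros Hc.
(* Placing the condition |z| < 1 under the existential, with default value 0 outside the disc, lets
   choice produce a total function. *)
assert (H : forall z, exists l, Cmod z < 1 -> csums_powers c z l).
{ intros z. destruct (Rlt_dec (Cmod z) 1) as [Hz|Hz]; [|now exists 0%C].
  pose proof (Cmod_ge_0 z).
  destruct (Hc ((1 + Cmod z) / 2) ltac:(lra)) as [K HK].
  destruct (ex_csums_coef c (fun n => z ^ n)%C K 1 ((1 + Cmod z) / 2) (Cmod z)) as [l Hl]; auto; try lra.
  - intros n. apply Cmod_pow_le. lra.
  - now exists l. }
exists (fun z => proj1_sig (constructive_indefinite_description _ (H z))).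
intros z. exact (proj2_sig (constructive_indefinite_description _ (H z))).
Qed.

(** This is n z^(n-1), given by the Leibniz recursion for z * z^n: no exponent n - 1 appears and the
    estimates become one-step inductions. *)
Fixpoint dpow (z : C) (n : nat) : C :=
  match n with O => 0%C | S n => (z * dpow z n + z ^ n)%C end.

Lemma dpow_S (z : C) (n : nat) : dpow z (S n) = (RtoC (INR (S n)) * z ^ n)%C.
Proof.
induction n as [|n IH]; [simpl; ring|].
change (dpow z (S (S n))) with (z * dpow z (S n) + z ^ S n)%C.
rewrite IH, (S_INR (S n)), RtoC_plus, !Cpow_S. ring.
Qed.

(** Enlarging the radius from q to r absorbs the factor n; the induction closes because q / (r - q)
    + 1 = r / (r - q). *)
Lemma Cmod_dpow_le (z : C) (q r : R) (n : nat) : Cmod z <= q -> q < r ->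
  Cmod (dpow z n) <= / (r - q) * r ^ n.
Proof.
intros Hz Hq. pose proof (Cmod_ge_0 z) as Hz0.
assert (Hi : 0 < / (r - q)) by (apply Rinv_0_lt_compat; lra).
induction n as [|n IH]; simpl.
- rewrite Cmod_0. lra.
- eapply Rle_trans; [apply Cmod_triangle|]. rewrite Cmod_mult.
  pose proof (Cmod_pow_le z q n Hz) as H1.
  assert (H2 : q ^ n <= r ^ n) by (apply pow_incr; lra).
  assert (H3 : Cmod z * Cmod (dpow z n) <= q * (/ (r - q) * r ^ n)).
  { apply Rmult_le_compat; auto using Cmod_ge_0. }
  replace (/ (r - q) * (r * r ^ n)) with (q * (/ (r - q) * r ^ n) + r ^ n) by (field; lra). lra.
Qed.

(** The remainders satisfy R_(n+1) = w R_n + [dpow z n] (w - z)^2, a recursion of the same shape as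
    the one for [dpow]. *)
Lemma Cmod_pow_taylor_le (z w : C) (q r : R) (n : nat) : Cmod z <= q -> Cmod w <= q -> q < r ->
  Cmod (w ^ n - z ^ n - dpow z n * (w - z)) <=
    (/ (r - q) * / (r - q) * (Cmod (w - z) * Cmod (w - z))) * r ^ n.
Proof.
intros Hz Hw Hq. pose proof (Cmod_ge_0 z) as Hz0. pose proof (Cmod_ge_0 (w - z)) as Hwz.
assert (Hi : 0 < / (r - q)) by (apply Rinv_0_lt_compat; lra).
induction n as [|n IH].
- simpl. replace (1 - 1 - 0 * (w - z))%C with (RtoC 0) by ring. rewrite Cmod_0.
  rewrite Rmult_1_r. apply Rmult_le_pos; nra.
- replace (w ^ S n - z ^ S n - dpow z (S n) * (w - z))%C with
    (w * (w ^ n - z ^ n - dpow z n * (w - z)) + dpow z n * ((w - z) * (w - z)))%C by (simpl; ring).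
  eapply Rle_trans; [apply Cmod_triangle|]. rewrite !Cmod_mult.
  pose proof (Cmod_dpow_le z q r n Hz Hq) as H1.
  set (e := Cmod (w - z) * Cmod (w - z)) in *.
  assert (He : 0 <= e) by (unfold e; nra).
  assert (H2 : Cmod w * Cmod (w ^ n - z ^ n - dpow z n * (w - z)) <= q * (/ (r - q) * / (r - q) * e * r ^ n)).
  { apply Rmult_le_compat; auto using Cmod_ge_0. }
  assert (H3 : Cmod (dpow z n) * e <= / (r - q) * r ^ n * e) by (apply Rmult_le_compat_r; auto).
  replace (/ (r - q) * / (r - q) * e * r ^ S n) with
    (q * (/ (r - q) * / (r - q) * e * r ^ n) + / (r - q) * r ^ n * e) by (simpl; field; lra).
  lra.
Qed.

Lemma power_series_derive (c : nat -> C) (f : C -> C) : subgeometric c ->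
  (forall z, Cmod z < 1 -> csums_powers c z (f z)) ->
  forall z, Cmod z < 1 -> exists l, csums (fun n => c n * dpow z n)%C l /\ is_Cderive f z l.
Proof.
intros Hc Hf z Hz. pose proof (Cmod_ge_0 z) as Hz0.
(* Nested radii |z| < q < r < s < 1: w stays within q, the remainders of the powers grow like r^n,
   and the coefficients are bounded at radius s. *)
set (m := (1 - Cmod z) / 4). set (q := Cmod z + m). set (r := q + m). set (s := r + m).
assert (Hm : 0 < m) by (unfold m; lra).
assert (Hs1 : s < 1) by (unfold s, r, q, m; lra).
destruct (Hc s ltac:(unfold s, r, q in *; lra)) as [K HK].
assert (HK0 : 0 <= K).
{ specialize (HK O). simpl in HK. pose proof (Cmod_ge_0 (c O)). lra. }
destruct (ex_csums_coef c (dpow z) K (/ (r - q)) s r) as [l Hl]; auto.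
{ unfold s, r, q; lra. }
{ intros n. apply Cmod_dpow_le; unfold r, q; lra. }
exists l. split; auto. apply is_Cderive_eps. intros eps Heps.
set (B := K * (/ (r - q) * / (r - q)) / (1 - r / s)).
assert (Hrs : 0 < 1 - r / s).
{ assert (r / s < 1); [|lra]. apply Rlt_div_l; unfold s, r, q in *; lra. }
assert (HB : 0 <= B).
{ apply Rmult_le_pos; [|left; now apply Rinv_0_lt_compat].
  assert (0 < / (r - q)) by (apply Rinv_0_lt_compat; unfold r; lra). nra. }
exists (Rmin m (eps / (1 + B))). split.
{ apply Rmin_pos; auto. apply Rdiv_lt_0_compat; lra. }
intros w Hw.
assert (H1 : Cmod (w - z) < m) by (eapply Rlt_le_trans; [exact Hw|apply Rmin_l]).
assert (H2 : Cmod (w - z) < eps / (1 + B)) by (eapply Rlt_le_trans; [exact Hw|apply Rmin_r]).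
assert (Hwq : Cmod w <= q).
{ unfold q. pose proof (Cmod_triangle_rev w z). lra. }
pose proof (Cmod_ge_0 (w - z)) as Hwz.
assert (H3 : csums (fun n => c n * (w ^ n - z ^ n - dpow z n * (w - z)))%C (f w - f z - l * (w - z))%C).
{ apply (csums_ext (fun n => c n * w ^ n - c n * z ^ n - (w - z) * (c n * dpow z n))%C); [intros; ring|].
  replace (l * (w - z))%C with ((w - z) * l)%C by ring.
  apply csums_minus; [apply csums_minus; apply Hf; unfold s, r, q in *; lra|].
  now apply csums_scal. }
assert (H4 : Cmod (f w - f z - l * (w - z)) <=
  K * (/ (r - q) * / (r - q) * (Cmod (w - z) * Cmod (w - z))) / (1 - r / s)).
{ apply (csums_coef_le c _ K _ s r) with (4 := H3); auto.
  - unfold s, r, q; lra.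
  - intros n. apply Cmod_pow_taylor_le; unfold r, q in *; lra. }
eapply Rle_trans; [exact H4|].
replace (K * (/ (r - q) * / (r - q) * (Cmod (w - z) * Cmod (w - z))) / (1 - r / s))
  with (B * Cmod (w - z) * Cmod (w - z)) by (unfold B, Rdiv; ring).
apply Rmult_le_compat_r; auto.
assert (H5 : eps / (1 + B) * (1 + B) = eps) by (field; lra).
apply Rle_trans with ((1 + B) * (eps / (1 + B))); [|lra].
apply Rmult_le_compat; lra.
Qed.

Lemma power_series_analytic (c : nat -> C) (f : C -> C) : subgeometric c ->
  (forall z, Cmod z < 1 -> csums_powers c z (f z)) -> analytic_D f.
Proof.
intros Hc Hf z Hz. destruct (power_series_derive c f Hc Hf z Hz) as [l [_ Hl]]. now exists l.
Qed.

Lemma subgeometric_shift (c : nat -> C) : subgeometric c -> subgeometric (fun n => c (S n)).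
Proof.
intros Hc r Hr. destruct (Hc r Hr) as [K HK]. exists (K / r).
apply coef_shift_le; [lra|exact HK].
Qed.

(** Shifting the coefficients divides by z and supplies the value at 0, so the removable singularity
    needs no separate treatment. *)
Lemma analytic_quotient (c : nat -> C) (f : C -> C) : subgeometric c ->
  (forall z, Cmod z < 1 -> csums_powers c z (f z)) -> f 0%C = 0%C ->
  exists V, analytic_D V /\ (forall z, Cmod z < 1 -> f z = (z * V z)%C) /\
    forall z, Cmod z < 1 -> csums_powers (fun n => c (S n)) z (V z).
Proof.
intros Hc Hs Hf0.
destruct (subgeometric_sum _ (subgeometric_shift c Hc)) as [V HV].
exists V. split; [eapply power_series_analytic; [|exact HV]; now apply subgeometric_shift|].
split; [|exact HV].
assert (H0 : c 0%nat = 0%C).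
{ rewrite <- Hf0. apply (csums_unique _ _ _ (csums_powers_0 c)). apply Hs. rewrite Cmod_0; lra. }
intros z Hz. rewrite (csums_powers_shift c z _ _ (Hs z Hz) (HV z Hz)), H0. ring.
Qed.

(** Termwise integration multiplies coefficients by 1 / (n + 1) <= 1, which keeps them subgeometric;
    no path independence is involved. *)
Lemma analytic_primitive (Q : C -> C) : analytic_D Q ->
  exists P : C -> C, P 0%C = 0%C /\ forall z, Cmod z < 1 -> is_Cderive P z (Q z).
Proof.
intros HQ. destruct (disc_power_series Q HQ) as [c [Hc [_ Hs]]].
set (d := fun n : nat => match n return C with O => RtoC 0 | S n => (/ RtoC (INR (S n)) * c n)%C end).
assert (HN : forall n, RtoC (INR (S n)) <> 0%C).
{ intros n E. apply RtoC_inj in E. revert E. apply not_0_INR. lia. }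
assert (Hd : subgeometric d).
{ intros r Hr. destruct (Hc r Hr) as [K HK].
  assert (HK0 : 0 <= K).
  { specialize (HK O). simpl in HK. pose proof (Cmod_ge_0 (c O)). lra. }
  exists K. intros [|n].
  - simpl. rewrite Cmod_0. lra.
  - change (d (S n)) with (/ RtoC (INR (S n)) * c n)%C. change (r ^ S n) with (r * r ^ n).
    rewrite Cmod_mult, Cmod_inv, Cmod_R by auto.
    assert (H1 : 1 <= INR (S n)) by (rewrite S_INR; pose proof (pos_INR n); lra).
    rewrite Rabs_pos_eq by lra.
    assert (H2 : 0 < / INR (S n) <= 1).
    { split; [apply Rinv_0_lt_compat; lra|]. rewrite <- Rinv_1. apply Rinv_le_contravar; lra. }
    specialize (HK n). assert (0 <= Cmod (c n) * r ^ n).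
    { apply Rmult_le_pos; [apply Cmod_ge_0|apply pow_le; lra]. }
    replace (/ INR (S n) * Cmod (c n) * (r * r ^ n)) with ((/ INR (S n) * r) * (Cmod (c n) * r ^ n)) by ring.
    apply Rle_trans with (1 * (Cmod (c n) * r ^ n)); [|lra].
    apply Rmult_le_compat_r; auto. nra. }
destruct (subgeometric_sum d Hd) as [P HP]. exists P. split.
{ symmetry. apply (csums_unique _ _ _ (csums_powers_0 d)). apply HP. rewrite Cmod_0; lra. }
intros z Hz. destruct (power_series_derive d P Hd HP z Hz) as [l [Hl1 Hl2]].
replace (Q z) with l; auto. apply csums_shift in Hl1.
replace (l - d 0%nat * dpow z 0)%C with l in Hl1 by (simpl; ring).
apply (csums_unique _ _ _ Hl1). specialize (Hs z Hz). revert Hs. apply csums_ext.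
intros n. rewrite dpow_S. unfold d. field. apply HN.
Qed.

(** * Bloch functions and the Alexander operator *)

Lemma is_Cderive_ext_disc (f g : C -> C) (z l : C) : Cmod z < 1 ->
  (forall w, Cmod w < 1 -> f w = g w) -> is_Cderive f z l -> is_Cderive g z l.
Proof.
intros Hz Hfg Hf. apply is_Cderive_eps. intros eps Heps.
destruct (proj1 (is_Cderive_eps _ _ _) Hf eps Heps) as [d [Hd0 Hd]].
exists (Rmin d (1 - Cmod z)). split; [apply Rmin_pos; lra|]. intros w Hw.
assert (H1 : Cmod (w - z) < d) by (eapply Rlt_le_trans; [exact Hw|apply Rmin_l]).
assert (H2 : Cmod (w - z) < 1 - Cmod z) by (eapply Rlt_le_trans; [exact Hw|apply Rmin_r]).
pose proof (Cmod_triangle_rev w z).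
rewrite <- !Hfg by lra. now apply Hd.
Qed.

Lemma C_derive_correct_disc (f : C -> C) (z : C) : analytic_D f -> Cmod z < 1 ->
  is_Cderive f z (C_derive f z).
Proof. intros Hf Hz. apply C_derive_correct; [exact z|now apply Hf]. Qed.

Lemma analytic_mult (f g : C -> C) : analytic_D f -> analytic_D g -> analytic_D (fun z => f z * g z)%C.
Proof. intros Hf Hg z Hz. apply ex_Cderive_mult; [apply Hf|apply Hg]; exact Hz. Qed.

(** * The Bloch weight and growth of Bloch functions *)

Lemma weight_pos (alpha : R) (z : C) : 0 < bloch_weight alpha z.
Proof. apply exp_pos. Qed.

Lemma weight_anti (alpha : R) (z w : C) : 0 < alpha -> Cmod w <= Cmod z -> Cmod z < 1 ->
  bloch_weight alpha z <= bloch_weight alpha w.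
Proof.
intros Ha Hwz Hz. pose proof (Cmod_ge_0 w). apply Rle_Rpower_l; [lra|]. split; nra.
Qed.

Lemma weight_le_1 (alpha : R) (z : C) : 0 < alpha -> Cmod z < 1 -> bloch_weight alpha z <= 1.
Proof.
intros Ha Hz. replace 1 with (bloch_weight alpha 0%C).
- apply weight_anti; auto. rewrite Cmod_0. apply Cmod_ge_0.
- unfold bloch_weight, Rpower. rewrite Cmod_0. replace (1 - 0 ^ 2) with 1 by ring.
  rewrite ln_1, Rmult_0_r. apply exp_0.
Qed.

Lemma weight_small (alpha eta : R) : 0 < alpha -> 0 < eta -> exists rho, 0 < rho < 1 /\
  forall z, rho <= Cmod z -> Cmod z < 1 -> bloch_weight alpha z <= eta.
Proof.
intros Ha He. set (y := Rpower eta (/ alpha)). assert (Hy : 0 < y) by apply exp_pos.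
set (x := Rmin (/ 2) y).
assert (Hx : 0 < x /\ x <= / 2 /\ x <= y).
{ unfold x. split; [apply Rmin_pos; lra|]. split; [apply Rmin_l|apply Rmin_r]. }
exists (1 - x / 2). split; [lra|]. intros z Hz1 Hz2.
replace eta with (Rpower y alpha).
- apply Rle_Rpower_l; [lra|]. split; nra.
- unfold y. rewrite Rpower_mult, Rinv_l by lra. now apply Rpower_1.
Qed.

Definition bloch_le (alpha : R) (f : C -> C) (M : R) : Prop :=
  forall z, Cmod z < 1 -> bloch_weight alpha z * Cmod (C_derive f z) <= M.

(** [real] sends an infinite supremum to 0; a finite bound must be known before [bloch_norm] can be
    read as a least upper bound. *)
Lemma bloch_norm_bounds (alpha : R) (f : C -> C) (B : R) : bloch_le alpha f B ->
  0 <= bloch_norm alpha f <= B /\ bloch_le alpha f (bloch_norm alpha f).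
Proof.
intros HB. unfold bloch_norm.
set (E := fun r => exists z : C, Cmod z < 1 /\ r = bloch_weight alpha z * Cmod (C_derive f z)).
destruct (Lub_Rbar_correct E) as [H1 H2].
assert (HBE : is_ub_Rbar E B).
{ intros x [z [Hz ->]]. exact (HB z Hz). }
specialize (H2 _ HBE).
assert (H0 : E (bloch_weight alpha 0%C * Cmod (C_derive f 0%C))).
{ exists 0%C. split; auto. rewrite Cmod_0; lra. }
pose proof (H1 _ H0) as H3.
destruct (Lub_Rbar E) as [l| |]; simpl in *; try contradiction.
assert (0 <= bloch_weight alpha 0%C * Cmod (C_derive f 0%C)).
{ apply Rmult_le_pos; [left; apply weight_pos|apply Cmod_ge_0]. }
split; [lra|]. intros z Hz. apply (H1 (bloch_weight alpha z * Cmod (C_derive f z))). now exists z.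
Qed.

(** On the segment from s z to z the weight is smallest at z, so |f'| <= M / weight(z) throughout,
    and the length is (1 - s) |z|. The choice s = 0 gives the growth bound, s near 1 the boundary
    estimate. *)
Lemma bloch_growth (alpha : R) (f : C -> C) (M s : R) (z : C) : 0 < alpha ->
  analytic_D f -> bloch_le alpha f M -> Cmod z < 1 -> 0 <= s <= 1 ->
  bloch_weight alpha z * Cmod (f z - f (RtoC s * z)%C) <= (1 - s) * Cmod z * M.
Proof.
intros Ha Hf HM Hz Hs. pose proof (Cmod_ge_0 z) as Hz0. pose proof (weight_pos alpha z) as Hw.
set (g := fun t : R => (RtoC s * z + RtoC (1 - s) * z * RtoC t)%C).
assert (Hg : forall t, 0 <= t <= 1 -> Cmod (g t) <= Cmod z).
{ intros t Ht. unfold g.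
  replace (RtoC s * z + RtoC (1 - s) * z * RtoC t)%C with (RtoC (s + (1 - s) * t) * z)%C
    by (rewrite RtoC_plus, RtoC_mult; ring).
  rewrite Cmod_mult, Cmod_R, Rabs_pos_eq by nra.
  rewrite <- (Rmult_1_l (Cmod z)) at 2. apply Rmult_le_compat_r; nra. }
assert (H := mean_value_path (fun t => f (g t)) (fun t => C_derive f (g t) * (RtoC (1 - s) * z))%C
  (M / bloch_weight alpha z * ((1 - s) * Cmod z))).
cbv beta in H.
replace (g 1) with z in H by (unfold g; rewrite RtoC_minus; ring).
replace (g 0) with (RtoC s * z)%C in H by (unfold g; ring).
apply (Rmult_le_reg_l (/ bloch_weight alpha z)); [now apply Rinv_0_lt_compat|].
rewrite <- Rmult_assoc, Rinv_l, Rmult_1_l by lra.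
replace (/ bloch_weight alpha z * ((1 - s) * Cmod z * M))
  with (M / bloch_weight alpha z * ((1 - s) * Cmod z)) by (unfold Rdiv; ring).
apply H.
- intros t Ht. apply (is_Pderive_comp f g).
  + apply C_derive_correct_disc; auto. specialize (Hg t Ht). lra.
  + unfold g. eapply is_Pderive_eq.
    * apply (is_Pderive_comp (fun w => RtoC s * z + RtoC (1 - s) * z * w)%C RtoC);
        [apply is_Cderive_affine|apply is_Pderive_RtoC].
    * ring.
- intros t Ht. specialize (Hg t Ht).
  rewrite !Cmod_mult, Cmod_R, (Rabs_pos_eq (1 - s)) by lra.
  apply Rmult_le_compat_r; [nra|].
  apply (proj1 (Rle_div_r _ _ _ Hw)). rewrite Rmult_comm.
  eapply Rle_trans; [|apply (HM (g t)); lra].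
  apply Rmult_le_compat_r; [apply Cmod_ge_0|]. apply weight_anti; auto.
Qed.

Lemma derive_at_0_mul (V : C -> C) : analytic_D V -> is_Cderive (fun z => z * V z)%C 0%C (V 0%C).
Proof.
intros HV. destruct (HV 0%C ltac:(rewrite Cmod_0; lra)) as [l Hl].
eapply is_Cderive_eq.
- apply (is_Cderive_mult (fun z => z) V); [apply is_Cderive_id|exact Hl].
- simpl. ring.
Qed.

(** Growth from the origin keeps a factor |z| that cancels the one in f = z V; at the origin V(0) =
    f'(0). *)
Lemma bloch_quotient_le (alpha : R) (f V : C -> C) (M : R) : 0 < alpha ->
  analytic_D f -> bloch_le alpha f M -> analytic_D V ->
  (forall z, Cmod z < 1 -> f z = (z * V z)%C) ->
  forall z, Cmod z < 1 -> bloch_weight alpha z * Cmod (V z) <= M.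
Proof.
intros Ha Hf HM HV HfV z Hz.
destruct (Ceq_dec z 0%C) as [->|Hz0].
- replace (V 0%C) with (C_derive f 0%C); [now apply HM|].
  apply is_C_derive_unique. apply (is_Cderive_ext_disc (fun z => z * V z)%C); auto.
  + intros w Hw. symmetry. now apply HfV.
  + now apply derive_at_0_mul.
- assert (Hz1 : 0 < Cmod z) by now apply Cmod_gt_0.
  pose proof (bloch_growth alpha f M 0 z Ha Hf HM Hz ltac:(lra)) as H.
  replace (f z - f (RtoC 0 * z)%C)%C with (z * V z)%C in H.
  + rewrite Cmod_mult in H. apply (Rmult_le_reg_l (Cmod z)); auto. lra.
  + rewrite <- HfV by auto. replace (RtoC 0 * z)%C with (RtoC 0) by ring.
    rewrite (HfV 0%C) by (rewrite Cmod_0; lra). ring.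
Qed.

(** This turns the segment integral into a primitive on the disc; all later facts about the operator
    are read off from that primitive and its derivative. *)
Lemma alexander_primitive (g f V P : C -> C) : analytic_D g -> analytic_D V ->
  (forall z, Cmod z < 1 -> f z = (z * V z)%C) ->
  P 0%C = 0%C -> (forall z, Cmod z < 1 -> is_Cderive P z (V z * g z)) ->
  forall z, Cmod z < 1 -> alexander g f z = P z.
Proof.
intros Hg HV HfV HP0 HP z Hz. unfold alexander. pose proof (Cmod_ge_0 z) as Hz1.
destruct (Ceq_dec z 0%C) as [->|Hz0]; [rewrite HP0; ring|].
assert (Hin : forall t, 0 <= t <= 1 -> Cmod (RtoC t * z) < 1).
{ intros t Ht. rewrite Cmod_mult, Cmod_R, Rabs_pos_eq by lra. nra. }
assert (Hpath : forall t, is_Pderive (fun t => RtoC t * z)%C t z).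
{ intros t. eapply is_Pderive_eq.
  - apply (is_Pderive_comp (fun w => w * z)%C RtoC); [|apply is_Pderive_RtoC].
    apply (is_Cderive_mult (fun w => w) (fun _ => z)); [apply is_Cderive_id|apply is_Cderive_const].
  - simpl. ring. }
set (q := fun t : R => (V (RtoC t * z) * g (RtoC t * z))%C).
assert (Hq : forall t, 0 <= t <= 1 -> Pcontinuous q t).
{ intros t Ht. apply (Pcontinuous_comp (fun w => V w * g w)%C (fun t => RtoC t * z)%C).
  - apply (analytic_mult V g HV Hg). now apply Hin.
  - eapply Pcontinuous_of_Pderive, Hpath. }
assert (E : RInt (V := C_R_CompleteNormedModule)
  (fun t : R => f (RtoC t * z) * g (RtoC t * z) / (RtoC t * z))%C 0 1 = PRInt q 0 1).
(* Equality is asked on the open interval only, which avoids the division by 0 at t = 0. *)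
{ apply (RInt_ext (V:=C_R_CompleteNormedModule)). rewrite Rmin_left, Rmax_right by lra.
  intros t Ht. unfold q. rewrite HfV by (apply Hin; lra).
  match goal with |- ?x = ?y => change (@eq C x y) end. field. split; auto.
  intros H. apply RtoC_inj in H. lra. }
rewrite E, <- PRInt_Cmult by (auto; lra).
apply (is_RInt_unique (V:=C_R_CompleteNormedModule)).
assert (H : is_PRInt (fun t => z * q t)%C 0 1 (P (RtoC 1 * z)%C - P (RtoC 0 * z)%C)).
{ apply (is_PRInt_derive (fun t => P (RtoC t * z)%C)); [lra| |].
  - intros t Ht. eapply is_Pderive_eq.
    + apply (is_Pderive_comp P (fun t => RtoC t * z)%C); [apply HP, Hin, Ht|apply Hpath].
    + unfold q. ring.
  - intros t Ht. apply Pcontinuous_mult; [apply Pcontinuous_const|auto]. }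
replace (RtoC 1 * z)%C with z in H by ring. replace (RtoC 0 * z)%C with (RtoC 0) in H by ring.
rewrite HP0 in H. replace (P z - 0)%C with (P z) in H by ring. exact H.
Qed.

Lemma alexander_0 (g f : C -> C) : alexander g f 0%C = 0%C.
Proof. unfold alexander. ring. Qed.

Lemma alexander_derive (g f V : C -> C) : analytic_D g -> analytic_D V ->
  (forall z, Cmod z < 1 -> f z = (z * V z)%C) ->
  forall z, Cmod z < 1 -> is_Cderive (alexander g f) z (V z * g z).
Proof.
intros Hg HV HfV z Hz.
destruct (analytic_primitive _ (analytic_mult V g HV Hg)) as [P [HP0 HP]].
apply (is_Cderive_ext_disc P); auto.
intros w Hw. symmetry. now apply (alexander_primitive g f V P).
Qed.

Lemma bloch0_quotient (alpha : R) (f : C -> C) : in_Bloch0 alpha f ->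
  exists V, analytic_D V /\ forall z, Cmod z < 1 -> f z = (z * V z)%C.
Proof.
intros [[Hf _] Hf0]. destruct (disc_power_series f Hf) as [c [Hc [_ Hs]]].
destruct (analytic_quotient c f Hc Hs Hf0) as [V [HV [HfV _]]]. now exists V.
Qed.

Lemma alexander_maps_Bloch0 (alpha G : R) (g : C -> C) : 0 < alpha -> analytic_D g ->
  (forall z, Cmod z < 1 -> Cmod (g z) <= G) -> maps_Bloch0 alpha (alexander g).
Proof.
intros Ha Hg HG f Hf. destruct (bloch0_quotient alpha f Hf) as [V [HV HfV]].
destruct Hf as [[Hf [M HM]] Hf0].
pose proof (alexander_derive g f V Hg HV HfV) as HT.
split; [|apply alexander_0]. split.
- intros z Hz. eexists. now apply HT.
- exists (M * G). intros z Hz. rewrite (is_C_derive_unique _ _ _ (HT z Hz)).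
  rewrite Cmod_mult, <- Rmult_assoc. apply Rmult_le_compat; try apply Cmod_ge_0.
  + apply Rmult_le_pos; [left; apply weight_pos|apply Cmod_ge_0].
  + now apply (bloch_quotient_le alpha f V M).
  + now apply HG.
Qed.

(** The same linear combination of the quotients V1, V2 and of the primitives P1, P2 satisfies the
    hypotheses of [alexander_primitive], so the integrals need not be split. *)
Lemma alexander_linear_on_Bloch0 (alpha : R) (g : C -> C) : analytic_D g ->
  linear_on_Bloch0 alpha (alexander g).
Proof.
intros Hg f1 f2 c1 c2 H1 H2 z Hz.
destruct (bloch0_quotient alpha f1 H1) as [V1 [HV1 HfV1]].
destruct (bloch0_quotient alpha f2 H2) as [V2 [HV2 HfV2]].
destruct (analytic_primitive _ (analytic_mult V1 g HV1 Hg)) as [P1 [HP10 HP1]].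
destruct (analytic_primitive _ (analytic_mult V2 g HV2 Hg)) as [P2 [HP20 HP2]].
rewrite (alexander_primitive g f1 V1 P1), (alexander_primitive g f2 V2 P2) by auto.
assert (Hlin : forall (A B : C -> C) w a b, is_Cderive A w a -> is_Cderive B w b ->
  is_Cderive (fun z => c1 * A z + c2 * B z)%C w (c1 * a + c2 * b)).
{ intros A B w a b HA HB. eapply is_Cderive_eq.
  - apply is_Cderive_plus; apply (is_Cderive_mult (fun _ => _)); first [apply is_Cderive_const|eassumption].
  - simpl. ring. }
apply (alexander_primitive g _ (fun z => c1 * V1 z + c2 * V2 z)%C (fun z => c1 * P1 z + c2 * P2 z)%C); auto.
- intros w Hw. destruct (HV1 w Hw) as [l1 Hl1]. destruct (HV2 w Hw) as [l2 Hl2].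
  exists (c1 * l1 + c2 * l2)%C. now apply Hlin.
- intros w Hw. rewrite HfV1, HfV2 by auto. ring.
- rewrite HP10, HP20. ring.
- intros w Hw. eapply is_Cderive_eq; [apply Hlin; [now apply HP1|now apply HP2]|]. simpl. ring.
Qed.

(** * Normal families and compactness *)

Definition Ctends (u : nat -> C) (l : C) : Prop := is_lim_seq (fun n => Cmod (u n - l)) 0.

(** Dominated convergence: J leading terms are peeled off and made small by coefficientwise
    convergence, the tail stays geometric. Each shift turns K into K / s and W into W r, hence the
    factor r / s. As N is chosen before w, the result is uniform in z when w is built from z. *)
Lemma csums_dominated (J : nat) : forall (d : nat -> nat -> C) (K W r s eps : R),
  0 <= r < s -> 0 <= W -> 0 < eps ->
  (forall n j, Cmod (d n j) * s ^ j <= K) -> (forall j, Ctends (fun n => d n j) 0%C) ->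
  exists N, forall n, (N <= n)%nat -> forall w l, (forall j, Cmod (w j) <= W * r ^ j) ->
    csums (fun j => d n j * w j)%C l -> Cmod l <= eps + K * W * (r / s) ^ J / (1 - r / s).
Proof.
induction J as [|J IH]; intros d K W r s eps Hr HW He HK Hd.
- exists O. intros n _ w l Hw Hl.
  pose proof (csums_coef_le (d n) w K W s r l Hr (HK n) Hw Hl). simpl. lra.
- destruct (IH (fun n j => d n (S j)) (K / s) (W * r) r s (eps / 2)) as [N1 HN1]; auto; try lra; try nra.
  { intros n. apply coef_shift_le; [lra|apply HK]. }
  destruct (is_lim_seq_0_le_eventually _ (Hd O) (eps / (2 * (1 + W)))) as [N0 HN0].
  { apply Rdiv_lt_0_compat; lra. }
  exists (max N0 N1). intros n Hn w l Hw Hl.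
  apply csums_shift in Hl.
  specialize (HN1 n ltac:(lia) (fun j => w (S j)) _ ltac:(intros j; specialize (Hw (S j)); simpl in Hw; lra) Hl).
  specialize (HN0 n ltac:(lia)). replace (d n 0%nat - 0)%C with (d n 0%nat) in HN0 by ring.
  assert (H0 : Cmod (d n 0%nat * w 0%nat) <= eps / 2).
  { rewrite Cmod_mult. specialize (Hw O). simpl in Hw.
    apply Rle_trans with (eps / (2 * (1 + W)) * (1 + W)); [|right; field; lra].
    apply Rmult_le_compat; try apply Cmod_ge_0; lra. }
  replace (K * W * (r / s) ^ S J / (1 - r / s)) with (K / s * (W * r) * (r / s) ^ J / (1 - r / s)).
  2: { simpl. unfold Rdiv. ring. }
  replace l with (d n 0%nat * w 0%nat + (l - d n 0%nat * w 0%nat))%C by ring.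
  eapply Rle_trans; [apply Cmod_triangle|]. lra.
Qed.

Lemma csums_uniformly_small (d : nat -> nat -> C) (K W r s eps : R) :
  0 <= r < s -> 0 <= W -> 0 < eps ->
  (forall n j, Cmod (d n j) * s ^ j <= K) -> (forall j, Ctends (fun n => d n j) 0%C) ->
  exists N, forall n, (N <= n)%nat -> forall w l, (forall j, Cmod (w j) <= W * r ^ j) ->
    csums (fun j => d n j * w j)%C l -> Cmod l <= eps.
Proof.
intros Hr HW He HK Hd.
assert (Hq : 0 <= r / s < 1).
{ split; [apply Rmult_le_pos; [lra|left; apply Rinv_0_lt_compat; lra]|apply Rlt_div_l; lra]. }
destruct (is_lim_seq_0_le_eventually _ (is_lim_seq_geom_scal (K * W / (1 - r / s)) _ Hq) (eps / 2)) as [J HJ];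
  [lra|].
specialize (HJ J (le_n _)).
destruct (csums_dominated J d K W r s (eps / 2) Hr HW ltac:(lra) HK Hd) as [N HN].
exists N. intros n Hn w l Hw Hl. specialize (HN n Hn w l Hw Hl).
replace (K * W * (r / s) ^ J / (1 - r / s)) with (K * W / (1 - r / s) * (r / s) ^ J) in HN
  by (unfold Rdiv; ring). lra.
Qed.

(** * Subsequences and diagonal extraction *)

Definition extraction (phi : nat -> nat) : Prop := forall n, (phi n < phi (S n))%nat.

Lemma extraction_ge (phi : nat -> nat) (n : nat) : extraction phi -> (n <= phi n)%nat.
Proof. intros H. induction n as [|n IH]; [lia|]. specialize (H n). lia. Qed.

Lemma extraction_mono (phi : nat -> nat) (m n : nat) : extraction phi -> (m < n)%nat -> (phi m < phi n)%nat.
Proof. intros H. induction 1 as [|n _ IH]; [apply H|]. specialize (H n). lia. Qed.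

Lemma extraction_comp (phi psi : nat -> nat) : extraction phi -> extraction psi ->
  extraction (fun n => phi (psi n)).
Proof. intros Hp Hq n. apply extraction_mono; auto. Qed.

Lemma is_lim_seq_0_reindex (u : nat -> R) (phi : nat -> nat) : (forall n, (n <= phi n)%nat) ->
  is_lim_seq u 0 -> is_lim_seq (fun n => u (phi n)) 0.
Proof.
intros Hp H P HP. destruct (H P HP) as [N HN]. exists N. intros n Hn. apply HN.
specialize (Hp n). lia.
Qed.

(** A cluster point has terms of arbitrarily large index within any tolerance; choosing them
    successively within 1 / (n + 1) gives the subsequence. *)
Lemma real_bounded_subsequence (u : nat -> R) (B : R) : (forall n, Rabs (u n) <= B) ->
  exists phi l, extraction phi /\ is_lim_seq (fun n => Rabs (u (phi n) - l)) 0.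
Proof.
intros HB.
destruct (Bolzano_Weierstrass u (fun x => - B <= x <= B)) as [l Hl].
{ apply compact_P3. }
{ intros n. apply Rabs_le_between, HB. }
assert (Hstep : forall n N, exists p, (N <= p)%nat /\ Rabs (u p - l) < / INR (S n)).
{ intros n N. assert (Hn : 0 < / INR (S n)) by (apply Rinv_0_lt_compat, lt_0_INR; lia).
  apply (Hl (fun x => Rabs (x - l) < / INR (S n))).
  exists (mkposreal _ Hn). intros x Hx. exact Hx. }
destruct (Hstep O O) as [p0 [_ Hp0]].
destruct (dependent_choice (fun n p => Rabs (u p - l) < / INR (S n)) (fun _ p q => (p < q)%nat) p0)
  as [phi [_ Hphi]]; auto.
{ intros n p _. destruct (Hstep (S n) (S p)) as [q [Hq1 Hq2]]. now exists q. }
exists phi, l. split; [intros n; apply Hphi|].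
apply is_lim_seq_0_le with (v := fun n => / INR (S n)).
- intros n. split; [apply Rabs_pos|]. left. apply Hphi.
- apply (is_lim_seq_incr_1 (fun n => / INR n)).
  apply (is_lim_seq_inv _ p_infty); [apply is_lim_seq_INR|discriminate].
Qed.

Lemma complex_bounded_subsequence (u : nat -> C) (B : R) : (forall n, Cmod (u n) <= B) ->
  exists phi l, extraction phi /\ Ctends (fun n => u (phi n)) l.
Proof.
intros HB.
destruct (real_bounded_subsequence (fun n => Re (u n)) B) as [phi [x [Hphi Hx]]].
{ intros n. eapply Rle_trans; [apply re_le_Cmod|apply HB]. }
destruct (real_bounded_subsequence (fun n => Im (u (phi n))) B) as [psi [y [Hpsi Hy]]].
{ intros n. eapply Rle_trans; [|apply (HB (phi n))]. eapply Rle_trans; [|apply Rmax_Cmod]. apply Rmax_r. }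
exists (fun n => phi (psi n)), (x, y). split; [now apply extraction_comp|].
apply is_lim_seq_0_le with (v := fun n =>
  Rabs (Re (u (phi (psi n))) - x) + Rabs (Im (u (phi (psi n))) - y)).
- intros n. split; [apply Cmod_ge_0|]. apply Cmod_le_abs.
- replace (Finite 0) with (Rbar_plus 0 0) by (simpl; f_equal; ring).
  apply is_lim_seq_plus'; auto.
  apply (is_lim_seq_0_reindex (fun n => Rabs (Re (u (phi n)) - x)) psi); auto.
  intros n. now apply extraction_ge.
Qed.

(** The state of the dependent choice is a whole extraction: stage j + 1 refines stage j so that
    coordinate j converges. *)
Lemma diagonal_subsequence (x : nat -> nat -> C) (B : nat -> R) :
  (forall n j, Cmod (x n j) <= B j) ->
  exists phi (l : nat -> C), extraction phi /\ forall j, Ctends (fun n => x (phi n) j) (l j).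
Proof.
intros HB.
destruct (dependent_choice (fun _ (p : nat -> nat) => extraction p)
  (fun j p q => exists sigma l, extraction sigma /\ (forall n, q n = p (sigma n)) /\
     Ctends (fun n => x (q n) j) l) (fun n => n)) as [psi [_ Hpsi]].
{ intros n. lia. }
{ intros j p Hp.
  destruct (complex_bounded_subsequence (fun n => x (p n) j) (B j)) as [sigma [l [Hs Hl]]]; [intros; apply HB|].
  exists (fun n => p (sigma n)). split; [now apply extraction_comp|].
  exists sigma, l. auto. }
assert (Hsub : forall i j, (i <= j)%nat -> exists sigma, extraction sigma /\ forall n, psi j n = psi i (sigma n)).
{ intros i j Hij. induction Hij as [|j _ [sigma [Hs1 Hs2]]].
  - exists (fun n => n). split; [intros n; lia|auto].
  - destruct (Hpsi j) as [_ [tau [_ [Ht1 [Ht2 _]]]]].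
    exists (fun n => sigma (tau n)). split; [now apply extraction_comp|].
    intros n. now rewrite Ht2, Hs2. }
exists (fun n => psi n n).
assert (Hl : forall j, exists l, Ctends (fun n => x (psi n n) j) l).
{ intros j. destruct (Hpsi j) as [_ [_ [l [_ [_ Hl]]]]]. exists l.
  apply is_lim_seq_0_eventually_le; [intros; apply Cmod_ge_0|]. intros eps Heps.
  destruct (is_lim_seq_0_le_eventually _ Hl eps Heps) as [N HN].
  (* Coordinate j converges along [psi (S j)], and the diagonal is drawn from that extraction only
     from index S j on. *)
  exists (max N (S j)). intros n Hn.
  destruct (Hsub (S j) n ltac:(lia)) as [sigma [Hs1 Hs2]]. rewrite Hs2. apply HN.
  pose proof (extraction_ge sigma n Hs1). lia. }
exists (fun j => proj1_sig (constructive_indefinite_description _ (Hl j))). split.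
- intros n. destruct (Hpsi n) as [Hn [sigma [_ [Hs1 [Hs2 _]]]]]. rewrite Hs2.
  pose proof (extraction_ge sigma (S n) Hs1). apply extraction_mono; auto.
- intros j. exact (proj2_sig (constructive_indefinite_description _ (Hl j))).
Qed.

Lemma Ctends_Cmod_le (u : nat -> C) (l : C) (K : R) : Ctends u l ->
  (forall n, Cmod (u n) <= K) -> Cmod l <= K.
Proof.
intros Hu HK. apply Rnot_lt_le. intros Hlt.
destruct (is_lim_seq_0_le_eventually _ Hu ((Cmod l - K) / 2)) as [N HN]; [lra|].
specialize (HN N (le_n _)). specialize (HK N).
pose proof (Cmod_triangle_rev l (u N)) as T. rewrite Cmod_minus_sym in T. lra.
Qed.

(** Montel's theorem for a Bloch ball, through Taylor coefficients. The ball is closed under this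
    convergence since derivatives converge pointwise, so the limit has the same bound M. *)
Lemma bloch_normal_family (alpha M : R) (u : nat -> C -> C) : 0 < alpha ->
  (forall n, analytic_D (u n)) -> (forall n, u n 0%C = 0%C) -> (forall n, bloch_le alpha (u n) M) ->
  exists phi f, extraction phi /\ analytic_D f /\ f 0%C = 0%C /\ bloch_le alpha f M /\
    exists (V : nat -> C -> C) (Vf : C -> C),
      (forall n, analytic_D (V n)) /\ (forall n z, Cmod z < 1 -> u (phi n) z = (z * V n z)%C) /\
      analytic_D Vf /\ (forall z, Cmod z < 1 -> f z = (z * Vf z)%C) /\
      forall rho eps, 0 < rho < 1 -> 0 < eps -> exists N, forall n, (N <= n)%nat ->
        forall z, Cmod z <= rho -> Cmod (V n z - Vf z) <= eps.
Proof.
intros Ha Hu Hu0 HM.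
assert (Hcoef : forall n, exists c : nat -> C, subgeometric c /\
    (forall r F, 0 < r < 1 -> (forall z, Cmod z = r -> Cmod (u n z) <= F) ->
       forall j, Cmod (c j) * r ^ j <= F) /\
    forall z, Cmod z < 1 -> csums_powers c z (u n z)).
{ intros n. apply disc_power_series, Hu. }
set (c := fun n => proj1_sig (constructive_indefinite_description _ (Hcoef n))).
assert (Hc : forall n, subgeometric (c n) /\
    (forall r F, 0 < r < 1 -> (forall z, Cmod z = r -> Cmod (u n z) <= F) ->
       forall j, Cmod (c n j) * r ^ j <= F) /\
    forall z, Cmod z < 1 -> csums_powers (c n) z (u n z)).
{ intros n. exact (proj2_sig (constructive_indefinite_description _ (Hcoef n))). }
clearbody c.
assert (HM0 : 0 <= M).
{ eapply Rle_trans; [|apply (HM O 0%C); rewrite Cmod_0; lra].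
  apply Rmult_le_pos; [left; apply weight_pos|apply Cmod_ge_0]. }
assert (HK : forall r, 0 < r < 1 -> exists K, forall n j, Cmod (c n j) * r ^ j <= K).
(* Growth from the origin bounds every [u n] by this constant on |z| = r; Cauchy's estimate
   transfers it to the coefficients, uniformly in n. *)
{ intros r Hr. exists (M / bloch_weight alpha (RtoC r)). intros n.
  apply (proj1 (proj2 (Hc n))); auto. intros z Hz.
  pose proof (weight_pos alpha z) as Hw.
  replace (bloch_weight alpha (RtoC r)) with (bloch_weight alpha z).
  2: { unfold bloch_weight. rewrite Hz, Cmod_R, Rabs_pos_eq; lra. }
  apply (proj1 (Rle_div_r _ _ _ Hw)).
  pose proof (bloch_growth alpha (u n) M 0 z Ha (Hu n) (HM n) ltac:(lra) ltac:(lra)) as H.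
  replace (u n z - u n (RtoC 0 * z)%C)%C with (u n z) in H.
  - rewrite Hz in H. nra.
  - replace (RtoC 0 * z)%C with (RtoC 0) by ring. rewrite Hu0. ring. }
destruct (HK (/ 2) ltac:(lra)) as [K2 HK2].
destruct (diagonal_subsequence c (fun j => K2 / (/ 2) ^ j)) as [phi [l [Hphi Hl]]].
{ intros n j. apply (proj1 (Rle_div_r _ _ _ (pow_lt (/ 2) j ltac:(lra)))). apply HK2. }
assert (HlK : forall r K, 0 < r < 1 -> (forall n j, Cmod (c n j) * r ^ j <= K) ->
  forall j, Cmod (l j) * r ^ j <= K).
{ intros r K Hr HrK j. assert (Hrj : 0 < r ^ j) by (apply pow_lt; lra).
  apply (proj2 (Rle_div_r _ _ _ Hrj)). apply (Ctends_Cmod_le _ _ _ (Hl j)).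
  intros n. apply (proj1 (Rle_div_r _ _ _ Hrj)). apply HrK. }
assert (Hlsub : subgeometric l).
{ intros r Hr. destruct (HK r Hr) as [K HrK]. exists K. now apply HlK. }
set (d := fun n j => (c (phi n) j - l j)%C).
assert (Hd0 : forall j, Ctends (fun n => d n j) 0%C).
{ intros j. apply (is_lim_seq_ext (fun n => Cmod (c (phi n) j - l j))); [|apply Hl].
  intros n. unfold d. f_equal. ring. }
assert (HdK : forall r, 0 < r < 1 -> exists K, forall n j, Cmod (d n j) * r ^ j <= K).
{ intros r Hr. destruct (HK r Hr) as [K HrK]. exists (K + K). intros n j. unfold d.
  specialize (HlK r K Hr HrK j). specialize (HrK (phi n) j).
  assert (0 <= r ^ j) by (apply pow_le; lra).
  pose proof (Cmod_triangle (c (phi n) j) (- l j)) as T. rewrite Cmod_opp in T.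
  apply Rle_trans with ((Cmod (c (phi n) j) + Cmod (l j)) * r ^ j); [|lra].
  apply Rmult_le_compat_r; auto. }
destruct (subgeometric_sum l Hlsub) as [f Hf].
assert (Hfa : analytic_D f) by (eapply power_series_analytic; eassumption).
assert (H01 : Cmod 0 < 1) by (rewrite Cmod_0; lra).
assert (Hc0 : forall n, c n 0%nat = 0%C).
{ intros n. rewrite <- (Hu0 n). apply (csums_unique _ _ _ (csums_powers_0 (c n))). now apply Hc. }
assert (Hf0 : f 0%C = 0%C).
{ rewrite <- (csums_unique _ _ _ (csums_powers_0 l) (Hf 0%C H01)).
  apply Cmod_eq_0, Rle_antisym; [|apply Cmod_ge_0].
  apply (Ctends_Cmod_le _ _ _ (Hl O)). intros n. rewrite Hc0, Cmod_0. lra. }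
assert (HfM : bloch_le alpha f M).
{ intros z Hz. pose proof (Cmod_ge_0 z) as Hz0.
  set (q := (1 + Cmod z) / 2). set (s := (1 + q) / 2). set (r := (q + s) / 2).
  assert (Hq : Cmod z < q /\ q < r /\ r < s /\ s < 1) by (unfold r, s, q; lra).
  clearbody q s r.
  destruct (power_series_derive l f Hlsub Hf z Hz) as [m [Hm1 Hm2]].
  rewrite (is_C_derive_unique _ _ _ Hm2).
  (* An excess of w |f'(z)| over M would be inherited, up to one half, by some [u (phi N)] whose
     derivative at z is within half the excess; w <= 1 prevents the weight from enlarging that
     error. *)
  apply Rnot_lt_le. intros Hlt. set (w := bloch_weight alpha z) in *.
  assert (Hw0 : 0 < w) by apply weight_pos.
  assert (Hw1 : w <= 1) by now apply weight_le_1.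
  destruct (HdK s ltac:(lra)) as [K HsK].
  destruct (csums_uniformly_small d K (/ (r - q)) r s ((w * Cmod m - M) / 2)) as [N HN]; auto; try lra.
  { left. apply Rinv_0_lt_compat. lra. }
  destruct (power_series_derive (c (phi N)) (u (phi N)) (proj1 (Hc _)) (proj2 (proj2 (Hc _))) z Hz)
    as [m' [Hm1' Hm2']].
  specialize (HM (phi N) z Hz). rewrite (is_C_derive_unique _ _ _ Hm2') in HM. fold w in HM.
  specialize (HN N (le_n _) (dpow z) (m' - m)%C).
  assert (Hb : Cmod (m' - m) <= (w * Cmod m - M) / 2).
  { apply HN.
    - intros j. apply Cmod_dpow_le; lra.
    - apply (csums_ext (fun j => c (phi N) j * dpow z j - l j * dpow z j)%C); [intros; unfold d; ring|].
      now apply csums_minus. }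
  pose proof (Cmod_triangle_rev m m') as T. rewrite Cmod_minus_sym in T.
  assert (w * (Cmod m - Cmod m') <= w * ((w * Cmod m - M) / 2)) by (apply Rmult_le_compat_l; lra).
  nra. }
destruct (analytic_quotient l f Hlsub Hf Hf0) as [Vf [HVf [HfVf HVs]]].
assert (HV : forall n, exists V, analytic_D V /\ (forall z, Cmod z < 1 -> u (phi n) z = (z * V z)%C) /\
    forall z, Cmod z < 1 -> csums_powers (fun j => c (phi n) (S j)) z (V z)).
{ intros n. apply analytic_quotient; auto; apply Hc. }
set (V := fun n => proj1_sig (constructive_indefinite_description _ (HV n))).
assert (HV' : forall n, analytic_D (V n) /\ (forall z, Cmod z < 1 -> u (phi n) z = (z * V n z)%C) /\
    forall z, Cmod z < 1 -> csums_powers (fun j => c (phi n) (S j)) z (V n z)).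
{ intros n. exact (proj2_sig (constructive_indefinite_description _ (HV n))). }
clearbody V.
exists phi, f. do 4 (split; auto). exists V, Vf.
split; [intros n; apply HV'|]. split; [intros n; apply HV'|]. do 2 (split; auto).
intros rho eps Hrho Heps.
destruct (HdK ((1 + rho) / 2) ltac:(lra)) as [K HrK].
(* The coefficients of V_n - Vf are the shifted differences; their bound at the intermediate radius
   (1 + rho) / 2 dominates the powers on |z| <= rho. *)
destruct (csums_uniformly_small (fun n j => d n (S j)) (K / ((1 + rho) / 2)) 1 rho ((1 + rho) / 2) eps)
  as [N HN]; auto; try lra.
{ intros n. apply coef_shift_le; [lra|apply HrK]. }
exists N. intros n Hn z Hz. apply (HN n Hn (fun j => z ^ j)%C).
- intros j. now apply Cmod_pow_le.
- apply (csums_ext (fun j => c (phi n) (S j) * z ^ j - l (S j) * z ^ j)%C); [intros; unfold d; ring|].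
  apply csums_minus; [apply HV'|apply HVs]; lra.
Qed.

Lemma bloch_le_minus (alpha : R) (f g : C -> C) (A B : R) : analytic_D f -> analytic_D g ->
  bloch_le alpha f A -> bloch_le alpha g B -> bloch_le alpha (fun z => f z - g z)%C (A + B).
Proof.
intros Hf Hg HA HB z Hz.
rewrite (is_C_derive_unique _ _ _ (is_Cderive_minus _ _ _ _ _
  (C_derive_correct_disc f z Hf Hz) (C_derive_correct_disc g z Hg Hz))).
specialize (HA z Hz). specialize (HB z Hz).
pose proof (Cmod_triangle (C_derive f z) (- C_derive g z)) as T. rewrite Cmod_opp in T.
pose proof (weight_pos alpha z).
apply Rle_trans with (bloch_weight alpha z * (Cmod (C_derive f z) + Cmod (C_derive g z))); [|lra].
apply Rmult_le_compat_l; [lra|exact T].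
Qed.

Lemma analytic_minus (f g : C -> C) : analytic_D f -> analytic_D g -> analytic_D (fun z => f z - g z)%C.
Proof.
intros Hf Hg z Hz. destruct (Hf z Hz) as [l Hl]. destruct (Hg z Hz) as [m Hm].
exists (l - m)%C. now apply is_Cderive_minus.
Qed.

(* The gain over [bloch_quotient_le]: near the circle the weight beats the growth of the function, since only the last piece of the radius, of length [1 - s], is not damped. *)
Lemma bloch_quotient_boundary (alpha M eps : R) : 0 < alpha -> 0 <= M -> 0 < eps ->
  exists rho, 0 < rho < 1 /\ forall v V, analytic_D v -> bloch_le alpha v M ->
    (forall z, Cmod z < 1 -> v z = (z * V z)%C) ->
    forall z, rho <= Cmod z -> Cmod z < 1 -> bloch_weight alpha z * Cmod (V z) <= eps.
Proof.
intros Ha HM He.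
(* The undamped piece from s z to z costs (1 - s) M <= eps / 2; the cap 1/2 keeps s positive. *)
set (s := 1 - Rmin (/ 2) (eps / (2 * (1 + M)))).
assert (Hs : / 2 <= s < 1 /\ (1 - s) * M <= eps / 2).
{ unfold s. assert (H1 : 0 < eps / (2 * (1 + M))) by (apply Rdiv_lt_0_compat; lra).
  pose proof (Rmin_l (/ 2) (eps / (2 * (1 + M)))). pose proof (Rmin_r (/ 2) (eps / (2 * (1 + M)))).
  assert (0 < Rmin (/ 2) (eps / (2 * (1 + M)))) by (apply Rmin_pos; lra).
  split; [lra|].
  apply Rle_trans with (eps / (2 * (1 + M)) * (1 + M)); [|right; field; lra].
  apply Rmult_le_compat; lra. }
clearbody s. destruct Hs as [Hs1 Hs2].
set (ws := bloch_weight alpha (RtoC s)). assert (Hws : 0 < ws) by apply weight_pos.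
(* Since ws |v(s z)| <= |z| M, this smallness of the weight at z makes the inner part at most |z|
   eps / 2. Both parts keep a factor |z|, which pays for the division of v by z. *)
destruct (weight_small alpha (ws * (eps / (2 * (1 + M))))) as [rho [Hrho Hwt]]; auto.
{ apply Rmult_lt_0_compat; auto. apply Rdiv_lt_0_compat; lra. }
exists rho. split; auto. intros v V Hv HvM HvV z Hz1 Hz2.
assert (Hz0 : 0 < Cmod z) by lra.
assert (Hsz : Cmod (RtoC s * z) = s * Cmod z) by (rewrite Cmod_mult, Cmod_R, Rabs_pos_eq; lra).
assert (Hsz1 : Cmod (RtoC s * z) < 1) by nra.
specialize (Hwt z Hz1 Hz2). set (w := bloch_weight alpha z) in *.
assert (Hw : 0 < w) by apply weight_pos.
pose proof (bloch_growth alpha v M s z Ha Hv HvM Hz2 ltac:(lra)) as G1. fold w in G1.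
pose proof (bloch_growth alpha v M 0 (RtoC s * z) Ha Hv HvM Hsz1 ltac:(lra)) as G2.
replace (v (RtoC s * z)%C - v (RtoC 0 * (RtoC s * z))%C)%C with (v (RtoC s * z)%C) in G2.
2: { replace (RtoC 0 * (RtoC s * z))%C with (RtoC 0) by ring.
     rewrite (HvV 0%C) by (rewrite Cmod_0; lra). ring. }
assert (G3 : ws * Cmod (v (RtoC s * z)%C) <= Cmod z * M).
{ apply Rle_trans with (bloch_weight alpha (RtoC s * z) * Cmod (v (RtoC s * z)%C)).
  - apply Rmult_le_compat_r; [apply Cmod_ge_0|]. apply weight_anti; auto.
    + rewrite Hsz, Cmod_R, Rabs_pos_eq by lra. nra.
    + rewrite Cmod_R, Rabs_pos_eq; lra.
  - eapply Rle_trans; [exact G2|]. rewrite Hsz.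
    assert (0 <= Cmod z * M) by (apply Rmult_le_pos; lra). nra. }
assert (G4 : w * Cmod (v (RtoC s * z)%C) <= Cmod z * (eps / 2)).
{ apply Rle_trans with (ws * (eps / (2 * (1 + M))) * Cmod (v (RtoC s * z)%C)).
  - apply Rmult_le_compat_r; [apply Cmod_ge_0|auto].
  - apply Rle_trans with (eps / (2 * (1 + M)) * (Cmod z * M)).
    + rewrite (Rmult_comm ws), Rmult_assoc. apply Rmult_le_compat_l; auto. left. apply Rdiv_lt_0_compat; lra.
    + replace (Cmod z * (eps / 2)) with (eps / (2 * (1 + M)) * (Cmod z * (1 + M))) by (field; lra).
      apply Rmult_le_compat_l; [left; apply Rdiv_lt_0_compat; lra|nra]. }
apply (Rmult_le_reg_l (Cmod z)); auto.
replace (Cmod z * (w * Cmod (V z))) with (w * Cmod (v z)) by (rewrite HvV, Cmod_mult by auto; ring).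
replace (v z) with ((v z - v (RtoC s * z)%C) + v (RtoC s * z)%C)%C by ring.
pose proof (Cmod_triangle (v z - v (RtoC s * z)%C) (v (RtoC s * z)%C)) as T.
apply (Rmult_le_compat_l w) in T; [|lra].
assert (Cmod z * ((1 - s) * M) <= Cmod z * (eps / 2)) by (apply Rmult_le_compat_l; lra).
nra.
Qed.

(** The limit of the images is the image of the locally uniform limit f, which lies in the space
    because the bound M survives. The norm of a difference of images is the supremum of the weight
    times |V_n - Vf| |g|, estimated separately inside and outside a circle. *)
Lemma alexander_compact_on_Bloch0 (alpha G : R) (g : C -> C) : 0 < alpha -> analytic_D g ->
  (forall z, Cmod z < 1 -> Cmod (g z) <= G) -> compact_on_Bloch0 alpha (alexander g).
Proof.
intros Ha Hg HG u Hu [M HuM].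
assert (HG0 : 0 <= G).
{ eapply Rle_trans; [apply Cmod_ge_0|apply (HG 0%C)]. rewrite Cmod_0; lra. }
assert (Hle : forall n, bloch_le alpha (u n) M).
{ intros n z Hz. destruct (Hu n) as [[_ [B HB]] _].
  destruct (bloch_norm_bounds alpha (u n) B HB) as [_ H].
  eapply Rle_trans; [now apply H|apply HuM]. }
assert (HM0 : 0 <= M).
{ eapply Rle_trans; [|apply (Hle O 0%C); rewrite Cmod_0; lra].
  apply Rmult_le_pos; [left; apply weight_pos|apply Cmod_ge_0]. }
destruct (bloch_normal_family alpha M u Ha) as
  [phi [f [Hphi [Hf [Hf0 [HfM [V [Vf [HV [HuV [HVf [HfV Hunif]]]]]]]]]]]]; auto.
{ intros n. apply Hu. } { intros n. apply Hu. }
exists phi. split; [exact Hphi|]. exists (alexander g f). split.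
{ apply (alexander_maps_Bloch0 alpha G); auto. split; auto. split; auto. now exists M. }
assert (Hder : forall n z, Cmod z < 1 ->
  C_derive (fun z => alexander g (u (phi n)) z - alexander g f z)%C z = ((V n z - Vf z) * g z)%C).
{ intros n z Hz. apply is_C_derive_unique. eapply is_Cderive_eq.
  - apply is_Cderive_minus.
    + now apply (alexander_derive g (u (phi n)) (V n)); auto.
    + now apply (alexander_derive g f Vf).
  - ring. }
assert (Hsmall : forall eps, 0 < eps -> exists N, forall n, (N <= n)%nat ->
  bloch_le alpha (fun z => alexander g (u (phi n)) z - alexander g f z)%C eps).
{ intros eps Heps. set (e := eps / (1 + G)).
  assert (He : 0 < e) by (apply Rdiv_lt_0_compat; lra).
  assert (HeG : e * G <= eps).
  { apply Rle_trans with (e * (1 + G)); [nra|right; unfold e; field; lra]. }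
  (* M + M bounds the differences u_n - f for all n at once, so rho is fixed before the interior
     convergence on |z| <= rho selects N. *)
  destruct (bloch_quotient_boundary alpha (M + M) e Ha ltac:(lra) He) as [rho [Hrho Hbd]].
  destruct (Hunif rho e Hrho He) as [N HN].
  exists N. intros n Hn z Hz. rewrite Hder, Cmod_mult, <- Rmult_assoc by auto.
  apply Rle_trans with (e * G); auto.
  pose proof (weight_pos alpha z). pose proof (Cmod_ge_0 (V n z - Vf z)).
  apply Rmult_le_compat; try apply Cmod_ge_0; [nra| |now apply HG].
  destruct (Rle_lt_dec rho (Cmod z)) as [Hr|Hr].
  - apply (Hbd (fun z => u (phi n) z - f z)%C (fun z => V n z - Vf z)%C); auto.
    + apply analytic_minus; auto. apply Hu.
    + apply bloch_le_minus; auto. apply Hu.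
    + intros x Hx. rewrite HuV, HfV by auto. ring.
  - specialize (HN n Hn z ltac:(lra)). pose proof (weight_le_1 alpha z Ha Hz). nra. }
(* A finite bound for every n, not just for large n, makes each norm a genuine supremum and hence
   nonnegative. *)
assert (Hbdd : forall n, exists B, bloch_le alpha (fun z => alexander g (u (phi n)) z - alexander g f z)%C B).
{ intros n.
  destruct (alexander_maps_Bloch0 alpha G g Ha Hg HG (u (phi n)) (Hu _)) as [[H1 [A HA]] _].
  destruct (alexander_maps_Bloch0 alpha G g Ha Hg HG f) as [[H2 [B HB]] _].
  { split; auto. split; auto. now exists M. }
  exists (A + B). now apply bloch_le_minus. }
apply is_lim_seq_0_eventually_le.
- intros n. destruct (Hbdd n) as [B HB]. apply (bloch_norm_bounds _ _ B HB).
- intros eps Heps. destruct (Hsmall eps Heps) as [N HN]. exists N. intros n Hn.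
  apply (bloch_norm_bounds _ _ eps (HN n Hn)).
Qed.

Theorem theorem3p3 :
  forall (alpha : R) (k : nat) (a : nat -> C) (h : C -> C),
    0 < alpha ->
    (1 <= k)%nat ->
    (forall j : nat, (j < k)%nat -> 0 < Cmod (a j)) ->
    analytic_D h ->
    (exists B : R, forall z : C, Cmod z < 1 -> Cmod (h z) <= B) ->
    maps_Bloch0 alpha (alexander (g0 k a h)) /\
    linear_on_Bloch0 alpha (alexander (g0 k a h)) /\
    compact_on_Bloch0 alpha (alexander (g0 k a h)).
Proof.
intros alpha k a h Ha _ _ Hh [B HB].
assert (Hg : analytic_D (g0 k a h)).
{ intros z Hz. destruct (Hh z Hz) as [l Hl]. eexists.
  apply (is_Cderive_plus (fun _ => csum a k) h); [apply is_Cderive_const|exact Hl]. }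
assert (HG : forall z, Cmod z < 1 -> Cmod (g0 k a h z) <= Cmod (csum a k) + B).
{ intros z Hz. eapply Rle_trans; [apply Cmod_triangle|]. specialize (HB z Hz). lra. }
split; [|split].
- eapply alexander_maps_Bloch0; eauto.
- now apply alexander_linear_on_Bloch0.
- eapply alexander_compact_on_Bloch0; eauto.
Qed.
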